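(* Suppose that the function $\varphi\in C^1(\mathbb{R}^d)$ is admissible. Let $\rho_\varphi$ be the Riemannian metric on $\mathbb{R}^d$ defined by the length element $ds^2=(1+|\nabla\varphi|)^2(dx_1^2+\cdots+dx_d^2)$, and let $d\mu_{\varphi}=e^{\varphi}\,d\lambda$, $d\mu_{-\varphi}=e^{-\varphi}\,d\lambda$, where $\lambda$ is the Lebesgue measure. Then (i) the metric measure space $(\mathbb{R}^d,\rho_\varphi,\mu_\varphi)$ is locally doubling, $\mu_\varphi(\mathbb{R}^d)=\infty$, and it satisfies property (I); (ii) the space $(\mathbb{R}^d,\rho_\varphi,\mu_{-\varphi})$ is locally doubling, $\mu_{-\varphi}(\mathbb{R}^d)<\infty$, and it satisfies property (I$^c_{B_0}$) for some ball $B_0\subset\mathbb{R}^d$.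
   Context: A positive function $m\in C^0(\mathbb{R}^d)$ is tame if for every $R>0$ there is a constant $C(R)\ge1$ such that $C(R)^{-1}\le m(x)/m(y)\le C(R)$ for all $x,y\in\mathbb{R}^d$ with $|x-y|<R$. A function $\varphi\in C^1(\mathbb{R}^d)$ is admissible if: (a) there exists $\tau_0>0$ such that $\varphi$ is $C^2$ for $|x|\ge\tau_0$; (b) $1+|\nabla\varphi|$ is tame, $\lim_{x\to\infty}|\nabla\varphi(x)|=\infty$ and $\lim_{x\to\infty}\frac{|\mathrm{Hess}\,\varphi(x)|}{|\nabla\varphi(x)|^2}=0$; (c) the radial derivative $\partial_r\varphi=\frac{x}{|x|}\cdot\nabla\varphi$ satisfies $\liminf_{x\to\infty}\frac{\partial_r\varphi(x)}{|\nabla\varphi(x)|}>0$. $\rho_\varphi$ also denotes the distance associated to the Riemannian metric. For a metric measure space $(M,\rho,\mu)$, a ball $B$ has radius $r_B$, and $2B$ is the ball with the same centre and radius $2r_B$. For $A\subset M$ and $\kappa>0$, $A_\kappa=\{x\in A:\rho(x,A^c)\le\kappa\}$. Locally doubling: for every $b>0$ there is a constant $D_b$ with $\mu(2B)\le D_b\,\mu(B)$ for all balls $B$ with $r_B\le b$. Property (I): there exist $\kappa_0,C>0$ such that for every bounded open set $A\subset M$, $\mu(A_\kappa)\ge C\kappa\,\mu(A)$ for all $\kappa\in(0,\kappa_0]$. Property (I$^c_{B_0}$): $B_0$ is a ball in $M$ and there exist $\kappa_0,C>0$ such that for every open set $A\subset M\setminus\overline{B}_0$, $\mu(A_\kappa)\ge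 C\kappa\,\mu(A)$ for all $\kappa\in(0,\kappa_0]$. *)

(* Defs.v *)
From HB Require Import structures.
From mathcomp Require Import all_boot all_order all_algebra.
From mathcomp Require Import all_classical all_reals all_analysis.

Set Implicit Arguments.
Unset Strict Implicit.
Unset Printing Implicit Defensive.

Import Order.TTheory GRing.Theory Num.Theory.
Import numFieldTopology.Exports numFieldNormedType.Exports.

Local Open Scope classical_set_scope.
Local Open Scope ring_scope.

Definition rV_display : measure_display.
Proof. exact: (measure_tuple_display default_measure_display). Qed.

Section measurable_rV.
Context (R : realType) (d : nat).

Definition rV_coord (i : 'I_d) (v : 'rV[R]_d) : measurableTypeR R := v ord0 i.

Let rV_set0 : g_sigma_preimage rV_coord set0.
Proof. exact: sigma_algebra0. Qed.

Let rV_setC A : g_sigma_preimage rV_coord A -> g_sigma_preimage rV_coord (~` A).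
Proof. exact: sigma_algebraC. Qed.

Let rV_bigcup (F : (set 'rV[R]_d)^nat) :
  (forall i, g_sigma_preimage rV_coord (F i)) ->
  g_sigma_preimage rV_coord (\bigcup_i (F i)).
Proof. exact: sigma_algebra_bigcup. Qed.

(* The product sigma-algebra on R^d, i.e. its Borel sigma-algebra, as for
   tuples in measurable_structure.v. *)
HB.instance Definition _ := @isMeasurable.Build rV_display
  'rV[R]_d (g_sigma_preimage rV_coord) rV_set0 rV_setC rV_bigcup.

Lemma measurable_rV_coord (i : 'I_d) : measurable_fun setT (rV_coord i).
Proof.
move=> _ Y mY; rewrite setTI; apply: sub_sigma_algebra => /=.
rewrite -bigcup_seq/=; exists i => /=; first by rewrite mem_index_enum.
by exists Y => //; rewrite setTI.
Qed.

Lemma measurable_fun_rVP (d' : measure_display) (T : measurableType d')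
    (f : T -> 'rV[R]_d) :
  (forall i, measurable_fun setT (rV_coord i \o f)) -> measurable_fun setT f.
Proof.
move=> mf _ A mA; rewrite setTI.
suff : g_sigma_preimage rV_coord `<=` image_set_system setT f measurable.
  by move=> /(_ _ mA); rewrite /image_set_system /= setTI.
apply: smallest_sub; first exact/sigma_algebra_image/sigma_algebra_measurable.
rewrite -bigcup_seq; apply: bigcup_sub => i _ B [Y mY <-].
by rewrite /image_set_system /= !setTI -[X in measurable X]setTI; exact: mf.
Qed.

End measurable_rV.

Section lebesgue_rV.
Context (R : realType).

Definition cons_rV (d : nat) (xv : measurableTypeR R * 'rV[R]_d) :
  'rV[R]_d.+1 := @row_mx R 1 1 d (scalar_mx xv.1) xv.2.

Definition uncons_rV (d : nat) (v : 'rV[R]_d.+1) :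
  measurableTypeR R * 'rV[R]_d := (v ord0 ord0, rsubmx (v : 'rV_(1 + d))).

Lemma uncons_rVK d : cancel (@uncons_rV d) (@cons_rV d).
Proof.
move=> v; apply/rowP => i; rewrite /cons_rV /uncons_rV/= mxE.
case: splitP => j ij.
  by rewrite !ord1 mxE eqxx; congr (v _ _); apply/val_inj; rewrite /= ij ord1.
by rewrite mxE; congr (v _ _); apply/val_inj; rewrite /= ij.
Qed.

Lemma cons_rVK d : cancel (@cons_rV d) (@uncons_rV d).
Proof.
move=> [x v]; rewrite /cons_rV /uncons_rV/= row_mxKr; congr pair.
by rewrite mxE; case: splitP => // j _; rewrite !ord1 mxE eqxx.
Qed.

Lemma measurable_cons_rV d : measurable_fun setT (@cons_rV d).
Proof.
apply: measurable_fun_rVP => i.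
case: (splitP (i : 'I_(1 + d))) => j ij.
  rewrite (_ : _ \o _ = fst) // funeqE => -[x v] /=.
  rewrite /rV_coord mxE; case: splitP => k ik; first by rewrite !ord1 mxE eqxx.
  by move: ij; rewrite ik ord1.
rewrite (_ : _ \o _ = @rV_coord R d j \o snd).
  by apply: measurableT_comp => //; exact: measurable_rV_coord.
rewrite funeqE => -[x v] /=; rewrite /rV_coord mxE; case: splitP => k ik.
  by move: ij; rewrite ik ord1.
by congr (v _ _); apply/val_inj/eqP; rewrite -(eqn_add2l 1) -ik ij.
Qed.

Lemma measurable_uncons_rV d : measurable_fun setT (@uncons_rV d).
Proof.
apply/measurable_fun_pairP; split; first exact: (@measurable_rV_coord R d.+1).
apply: measurable_fun_rVP => i.
rewrite (_ : _ \o _ = @rV_coord R d.+1 (rshift 1 i)).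
  exact: measurable_rV_coord.
by rewrite funeqE => v; rewrite /rV_coord /= mxE.
Qed.

HB.instance Definition _ d :=
  isMeasurableFun.Build _ _ _ _ (@cons_rV d) (@measurable_cons_rV d).

Section step.
Context (d : nat) (m : {sigma_finite_measure set 'rV[R]_d -> \bar R}).

Definition lebesgue_rV_step : set 'rV[R]_d.+1 -> \bar R :=
  pushforward (@lebesgue_measure R \x m)%E (@cons_rV d).

Let step0 : lebesgue_rV_step set0 = 0%E.
Proof. exact: measure0. Qed.

Let step_ge0 A : (0 <= lebesgue_rV_step A)%E.
Proof. exact: measure_ge0. Qed.

Let step_sigma_additive : semi_sigma_additive lebesgue_rV_step.
Proof. exact: measure_semi_sigma_additive. Qed.

HB.instance Definition _ := isMeasure.Build _ _ _ lebesgue_rV_step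
  step0 step_ge0 step_sigma_additive.

Let sigma_finite_step : sigma_finite setT lebesgue_rV_step.
Proof.
have /sigma_finiteP[F [TF ndF Foo]] := sigma_finiteT (@lebesgue_measure R).
have /sigma_finiteP[G [TG ndG Goo]] := sigma_finiteT m.
exists (fun n => @uncons_rV d @^-1` (F n `*` G n)).
  rewrite -preimage_bigcup -[LHS](preimage_setT (@uncons_rV d)).
  congr (_ @^-1` _); rewrite -setXTT TF TG predeqE => -[x y]; split.
    move=> [/= [n _ Fnx] [k _ Gky]]; exists (maxn n k) => //; split.
    - by move: x Fnx; exact/subsetPset/ndF/leq_maxl.
    - by move: y Gky; exact/subsetPset/ndG/leq_maxr.
  by move=> [n _ []/= ? ?]; split; exists n.
move=> n; have [mFn Fnoo] := Foo n; have [mGn Gnoo] := Goo n.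
have mFG : measurable (F n `*` G n) by exact: measurableX.
split; first by rewrite -[X in measurable X]setTI; exact: measurable_uncons_rV.
rewrite /lebesgue_rV_step /pushforward -comp_preimage.
rewrite (_ : _ \o _ = id); last by rewrite funeqE => x /=; rewrite cons_rVK.
by rewrite preimage_id product_measure1E// lte_mul_pinfty// ge0_fin_numE.
Qed.

HB.instance Definition _ := Measure_isSigmaFinite.Build _ _ _
  lebesgue_rV_step sigma_finite_step.

End step.

Fixpoint lebesgue_rV (d : nat) :
    {sigma_finite_measure set 'rV[R]_d -> \bar R} :=
  match d with
  | 0 => dirac (0 : 'rV[R]_0)
  | d'.+1 => lebesgue_rV_step (lebesgue_rV d')
  end.

End lebesgue_rV.

Lemma cons_rV0 (R : realType) d (x : R) (v : 'rV[R]_d) :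
  cons_rV (x, v) ord0 ord0 = x.
Proof. by rewrite mxE; case: splitP => // j _; rewrite !ord1 mxE eqxx. Qed.

Lemma cons_rVS (R : realType) d (x : R) (v : 'rV[R]_d) i :
  cons_rV (x, v) ord0 (lift ord0 i) = v ord0 i.
Proof.
rewrite mxE; case: splitP => k ik; first by move: ik; rewrite ord1.
by congr (v _ _); apply/val_inj/eqP; rewrite -(eqn_add2l 1) -ik.
Qed.

Lemma measurable_box_rV (R : realType) (d : nat)
    (I : 'I_d -> set (measurableTypeR R)) :
  (forall i, measurable (I i)) ->
  measurable [set v : 'rV[R]_d | forall i, I i (v ord0 i)].
Proof.
move=> mI; rewrite (_ : [set _ | _] =
    \big[setI/setT]_(i < d) (@rV_coord R d i @^-1` I i)).
  apply: bigsetI_measurable => i _; rewrite -[X in measurable X]setTI.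
  exact: measurable_rV_coord.
rewrite -bigcap_seq; apply/seteqP; split => v /= Iv i; first by move=> _; exact: Iv.
by apply: Iv; rewrite /= mem_index_enum.
Qed.

Lemma lebesgue_rV_box (R : realType) (d : nat)
    (I : 'I_d -> set (measurableTypeR R)) :
  (forall i, measurable (I i)) ->
  lebesgue_rV R d [set v | forall i, I i (v ord0 i)] =
  (\prod_(i < d) lebesgue_measure (I i))%E.
Proof.
elim: d I => [|d IH] I mI.
  by rewrite big_ord0 /= diracE mem_set// => -[].
rewrite big_ord_recl -IH => [|i]; last exact: mI.
rewrite -product_measure1E//; last first.
  exact: (@measurable_box_rV _ _ (fun i => I (lift ord0 i))).
rewrite /= /lebesgue_rV_step /pushforward; congr product_measure1.
apply/seteqP; split => -[x v] /=.
  move=> Iv; split => [|i]; first by have := Iv ord0; rewrite cons_rV0.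
  by have := Iv (lift ord0 i); rewrite cons_rVS.
move=> [Ix Iv] i; case: (unliftP ord0 i) => [j|] ->.
  by rewrite cons_rVS.
by rewrite cons_rV0.
Qed.

Section euclidean_calculus.
Context (R : realType).

(* The library norm of 'M[R]_(m, n) is the maximum norm: enorm is the Euclidean
   norm of a vector and the Hilbert-Schmidt norm of a matrix. *)
Definition enorm (m n : nat) (A : 'M[R]_(m, n)) : R :=
  Num.sqrt (\sum_i \sum_j A i j ^+ 2).

Context (d : nat).
Implicit Types (phi w : 'rV[R]_d -> R) (x y : 'rV[R]_d).

Definition dotrV x y : R := \sum_i x ord0 i * y ord0 i.

Definition grad phi x : 'rV[R]_d :=
  \row_i 'D_(delta_mx ord0 i : 'rV[R]_d) phi x.

Definition hess phi x : 'M[R]_d :=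
  \matrix_(i, j)
    'D_(delta_mx ord0 i : 'rV[R]_d) (fun y => grad phi y ord0 j) x.

(* the filter of neighbourhoods of infinity, i.e. "as |x| tends to infinity" *)
Definition at_infty : set_system 'rV[R]_d :=
  [set P | exists M : R, forall x, M < enorm x -> P x].

Global Instance at_infty_filter : Filter at_infty.
Proof.
split; first by exists 0.
- move=> P Q [M PM] [N QN]; exists (Num.max M N) => x.
  by rewrite gt_max => /andP[Mx Nx]; split; [exact: PM|exact: QN].
- by move=> P Q PQ [M PM]; exists M => x /PM /PQ.
Qed.

Definition C1_fun phi : Prop :=
  (forall x, differentiable phi x) /\ continuous (grad phi).

(* For phi already of class C^1. *)
Definition C2_on (D : set 'rV[R]_d) phi : Prop :=
  (forall x, D x -> differentiable (grad phi) x) /\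
  {within D, continuous (hess phi)}.

Definition radial_derivative phi x : R :=
  dotrV ((enorm x)^-1 *: x) (grad phi x).

Definition tame w : Prop :=
  [/\ forall x, 0 < w x,
      continuous w &
      forall r : R, 0 < r -> exists2 C : R, 1 <= C &
        forall x y, enorm (x - y) < r -> C^-1 <= w x / w y <= C].

Record admissible phi : Prop := Admissible {
  admissible_C1 : C1_fun phi ;
  admissible_C2 : exists2 tau0 : R, 0 < tau0 &
    C2_on [set x | tau0 <= enorm x] phi ;
  admissible_tame : tame (fun x => 1 + enorm (grad phi x)) ;
  admissible_grad : enorm (grad phi x) @[x --> at_infty] --> +oo ;
  admissible_hess :
    enorm (hess phi x) / enorm (grad phi x) ^+ 2 @[x --> at_infty] --> 0 ;
  admissible_radial :
    (0 < limf_einf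
           (fun x => (radial_derivative phi x / enorm (grad phi x))%:E)
           at_infty)%E }.

Definition C1_curve (g : R -> 'rV[R]_d) : Prop :=
  (forall t, derivable g t 1) /\ continuous (derive1 g).

(* There is a subdivision 0 = s_0 < ... < s_k = 1 such that g is C^1 up to the
   end points on each closed interval [s_i, s_(i+1)], which is expressed by the
   existence of a C^1 extension to R. *)
Definition piecewise_C1 (g : R -> 'rV[R]_d) : Prop :=
  exists s : seq R, [/\ path <%R 0 s, last 0 s = 1 &
    forall i, (i < size s)%N -> exists2 h, C1_curve h &
      forall t, nth 0 (0 :: s) i <= t <= nth 0 s i -> g t = h t].

Definition curve_from_to x y : set (R -> 'rV[R]_d) :=
  [set g | [/\ piecewise_C1 g, g 0 = x & g 1 = y]].

(* Length for the length element ds = w |dx|; the finitely many points where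
   the derivative of g may fail to exist are negligible. *)
Definition curve_length w (g : R -> 'rV[R]_d) : \bar R :=
  (\int[lebesgue_measure]_(t in `[0%R, 1%R]) (w (g t) * enorm (derive1 g t))%:E)%E.

Definition conformal_dist w x y : R :=
  fine (ereal_inf (curve_length w @` curve_from_to x y)).

Definition rho_ phi : 'rV[R]_d -> 'rV[R]_d -> R :=
  conformal_dist (fun x => 1 + enorm (grad phi x)).

Definition mu_ phi (A : set 'rV[R]_d) : \bar R :=
  (\int[lebesgue_rV R d]_(x in A) (expR (phi x))%:E)%E.

End euclidean_calculus.

Section metric_measure_space.
Context (R : realType) (M : Type) (rho : M -> M -> R) (mu : set M -> \bar R).
Implicit Types (A : set M) (x y : M) (r b kappa : R).

Definition mball x r : set M := [set y | rho x y < r].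

Definition mopen A : Prop :=
  forall x, A x -> exists2 r, 0 < r & mball x r `<=` A.

Definition mclosure A : set M :=
  [set x | forall r, 0 < r -> mball x r `&` A !=set0].

Definition mbounded A : Prop :=
  exists r, forall x y, A x -> A y -> rho x y <= r.

(* +oo when A is empty *)
Definition dist_to_set x A : \bar R := ereal_inf [set (rho x y)%:E | y in A].

Definition boundary_layer A kappa : set M :=
  [set x | A x /\ (dist_to_set x (~` A) <= kappa%:E)%E].

Definition locally_doubling : Prop :=
  forall b, 0 < b -> exists D : R, forall x r, 0 < r -> r <= b ->
    (mu (mball x (2 * r)) <= D%:E * mu (mball x r))%E.

Definition property_I : Prop :=
  exists kappa0 C : R, [/\ 0 < kappa0, 0 < C &
    forall A, mbounded A -> mopen A ->
    forall kappa, 0 < kappa -> kappa <= kappa0 ->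
      ((C * kappa)%:E * mu A <= mu (boundary_layer A kappa))%E].

Definition property_Ic (B0 : set M) : Prop :=
  exists kappa0 C : R, [/\ 0 < kappa0, 0 < C &
    forall A, mopen A -> A `<=` ~` mclosure B0 ->
    forall kappa, 0 < kappa -> kappa <= kappa0 ->
      ((C * kappa)%:E * mu A <= mu (boundary_layer A kappa))%E].

End metric_measure_space.

(* Main.v *)
From HB Require Import structures.
Require Import Defs.
From mathcomp Require Import all_boot all_order all_algebra.
From mathcomp Require Import all_classical all_reals all_analysis.
From mathcomp Require Import measurable_realfun ring lra.

Set Implicit Arguments.
Unset Strict Implicit.
Unset Printing Implicit Defensive.

Import Order.TTheory GRing.Theory Num.Theory.
Import numFieldTopology.Exports numFieldNormedType.Exports.

Local Open Scope classical_set_scope.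
Local Open Scope ring_scope.

(** Let [w := 1 + |grad phi|] be the weight of the metric.

    Doubling. Tameness says that [w] is comparable to a constant on Euclidean
    balls of bounded radius. Since [w >= 1], a curve of bounded length stays in
    such a ball, so a metric ball of radius [r <= b] about [x] lies between two
    cubes of side comparable to [r / w x] ([rho_le], [rho_ball_subset]). The
    gradient of [phi] is at most [w], so [phi] oscillates by a bounded amount on
    such cubes ([potential_harnack]) and both densities are essentially constant
    there ([doubling]).

    Isoperimetry. Suppose that a vector field [X] has metric norm at most a
    constant and that its divergence with respect to the measure is at least
    [c > 0] on the open set [A]. Testing the divergence theorem for [X] against a
    function [f] equal to 0 off [A], equal to 1 on [A] at distance at least
    [kappa] from the complement, and [C / kappa]-Lipschitz for the metric gives
    [c * int f <= (C' / kappa) * mu (A_kappa)], hence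
    [mu A <= (C'' / kappa) * mu (A_kappa)]. In [vector_field_isoperimetry] the
    divergence theorem is obtained from difference quotients in the coordinate
    directions, translation invariance of Lebesgue measure moving them from the
    field to [f], so that [f] has only to be Lipschitz.

    The vector field. For the density [expR (s * phi)] with [s = 1] or [s = -1]
    take [X := s grad phi / |grad phi|^2]. Its metric norm is bounded, and its
    divergence with respect to the measure is [1 + s div (grad phi / |grad
    phi|^2)], where the last term is controlled by [|Hess phi| / |grad phi|^2]
    and tends to 0 at infinity. Near the origin [X] is switched off by a radial
    cutoff [eta]. When [s = 1], the condition on the radial derivative makes the
    term [X . grad eta] nonnegative, and a small multiple of a compactly
    supported field of the form [q(|x|^2) x], with positive divergence near the
    origin, completes [X] to a field that works on the whole space
    ([calibrated_plus]): this is property (I). When [s = -1], the field works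
    outside a ball ([calibrated_minus]): this is property (I^c) for bounded sets.

    Total masses. Integrating the radial derivative along rays gives
    [phi x >= c |x| - C] ([potential_growth]). Hence [expR phi] is bounded below
    and its measure is infinite, whereas annuli of width 1 and radius [n] have
    measure [O(1/n)] for the density [expR (- phi)] ([mu_annulus_le]). Truncating
    a set to large balls therefore costs nothing in the limit, which removes the
    boundedness assumption ([isoperimetry_minus]); applied to the complement of
    a ball, the resulting inequality bounds its measure by that of a bounded
    layer ([mu_finite]). *)

(** * Measure theory on row vectors *)

Section max_norm.
Context (R : realType) (d : nat).
Implicit Types (x y v : 'rV[R]_d).

Lemma coord_le_norm v i : `|v ord0 i| <= `|v|.
Proof.
rewrite [leRHS]/Num.Def.normr /= mx_normrE.
by apply: (le_bigmax _ (fun ij => `|v ij.1 ij.2|) (ord0, i)).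
Qed.

Lemma norm_leP v e : 0 <= e -> (`|v| <= e) <-> (forall i, `|v ord0 i| <= e).
Proof.
move=> e0; split=> [ve i|ve]; first exact: le_trans (coord_le_norm v i) ve.
rewrite [leLHS]/Num.Def.normr /= mx_normrE; apply: bigmax_le => // -[i j] _ /=.
by rewrite ord1; exact: ve.
Qed.

Lemma norm_ltP v e : 0 < e -> (`|v| < e) <-> (forall i, `|v ord0 i| < e).
Proof.
move=> e0; split=> [ve i|ve]; first exact: le_lt_trans (coord_le_norm v i) ve.
rewrite [ltLHS]/Num.Def.normr /= mx_normrE; apply: bigmax_lt => // -[i j] _ /=.
by rewrite ord1; exact: ve.
Qed.

End max_norm.

Section ge0_integral_monotone.
Context d (T : measurableType d) (R : realType).
Context (mu : {measure set T -> \bar R}).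

(** The integral of a nonnegative function is a supremum over the simple
    functions below it, so it is monotone even without measurability; this
    is what allows metric balls and boundary layers to be compared with
    measurable sets before knowing that they are measurable. *)
Lemma ge0_integral_mono (A B : set T) (f g : T -> \bar R) :
  (forall x, A x -> (0 <= f x)%E) -> (forall x, B x -> (0 <= g x)%E) ->
  (forall x, A x -> B x /\ (f x <= g x)%E) ->
  (\int[mu]_(x in A) f x <= \int[mu]_(x in B) g x)%E.
Proof.
move=> f0 g0 fg; rewrite !ge0_integralE//; apply: le_ereal_sup.
move=> _ /= [h hf <-]; exists h => // x.
apply: (le_trans (hf x)); rewrite !patchE; case: ifPn => [/set_mem Ax|_].
  by have [Bx ?] := fg _ Ax; rewrite ifT// mem_set.
by case: ifPn => // /set_mem; exact: g0.
Qed.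

End ge0_integral_monotone.

Section borel.
Context (R : realType) (d : nat).

(** An open set is the union of the countably many boxes with rational
    vertices that it contains. *)
Lemma open_measurable_rV (U : set 'rV[R]_d) : open U -> measurable U.
Proof.
move=> oU.
pose box (q : 'rV[rat]_d * 'rV[rat]_d) : set 'rV[R]_d :=
  [set v | forall i, v ord0 i \in `]ratr (q.1 ord0 i), ratr (q.2 ord0 i)[].
pose F q := if `[< box q `<=` U >] then box q else set0.
rewrite (_ : U = \bigcup_q F q).
  apply: countable_bigcupT_measurable => [|q]; first exact: countableP.
  rewrite /F; case: ifPn => _; last exact: measurable0.
  exact: (@measurable_box_rV R d
    (fun i => [set` `]ratr (q.1 ord0 i), ratr (q.2 ord0 i)[])).
apply/seteqP; split => [x Ux|x [q _]]; last first.
  by rewrite /F; case: ifPn => // /asboolP qU /qU.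
have [e e0 xeU] : exists2 e : R, 0 < e & ball x e `<=` U.
  by move/nbhs_ballP : (open_nbhs_nbhs (conj oU Ux)) => [e /= e0 ?]; exists e.
have H1 i : exists q : rat, ratr q \in `]x ord0 i - e, x ord0 i[.
  by apply: rat_in_itvoo; rewrite ltrBlDr ltrDl.
have H2 i : exists q : rat, ratr q \in `]x ord0 i, x ord0 i + e[.
  by apply: rat_in_itvoo; rewrite ltrDl.
pose q : 'rV[rat]_d * 'rV[rat]_d :=
  (\row_i projT1 (cid (H1 i)), \row_i projT1 (cid (H2 i))).
exists q => //; rewrite /F ifT.
  move=> i; rewrite !mxE.
  case: (cid (H1 i)) => a; case: (cid (H2 i)) => b /=.
  by rewrite !in_itv/= => /andP[? ?] /andP[? ?]; apply/andP.
apply/asboolP => y yq; apply: xeU.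
rewrite mx_norm_ball /ball_ /=; apply/norm_ltP => // i.
move: (yq i); rewrite !mxE.
case: (cid (H1 i)) => a; case: (cid (H2 i)) => b /=.
rewrite !in_itv/= => /andP[? ?] /andP[? ?] /andP[? ?].
by rewrite ltr_norml; apply/andP; split; lra.
Qed.

Lemma continuous_measurable_rV (f : 'rV[R]_d -> R) :
  continuous f -> measurable_fun setT (f : _ -> measurableTypeR R).
Proof.
move=> /continuousP cf; apply: (measurability _ (RGenOInfty.measurableE R)).
move=> _ [_ [a ->] <-]; rewrite setTI; apply: open_measurable_rV.
exact/cf/interval_open.
Qed.

End borel.

Section translation.
Context (R : realType).

Lemma measurable_shift_rV d (a : 'rV[R]_d) :
  measurable_fun setT (fun x : 'rV[R]_d => x + a).
Proof.
apply: measurable_fun_rVP => i.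
rewrite (_ : _ \o _ = (fun x => rV_coord i x + a ord0 i)); last first.
  by apply/funext => x; rewrite /rV_coord /= mxE.
by apply: measurable_funD => //; exact: measurable_rV_coord.
Qed.

Lemma lebesgue_measure_shift (c : R) (A : set (measurableTypeR R)) :
  measurable A ->
  lebesgue_measure ((fun x => x + c) @^-1` A) = lebesgue_measure A.
Proof.
move=> mA; have mc : measurable_fun setT
  ((fun x => x + c) : measurableTypeR R -> measurableTypeR R).
  exact: measurable_funD.
pose m := isMeasurableFun.Build _ _ _ _ _ mc.
pose f : {mfun measurableTypeR R >-> measurableTypeR R} := HB.pack (fun x => x + c) m.
apply/esym/(@lebesgue_measure_unique _ (pushforward lebesgue_measure f)) => //.
move=> _ [[a b]] _ <-.
transitivity (lebesgue_measure [set` `]a - c, b - c]]); last first.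
  congr lebesgue_measure; apply/seteqP; split => x /=.
    by rewrite !in_itv/= => /andP[? ?]; apply/andP; split; lra.
  by rewrite !in_itv/= => /andP[? ?]; apply/andP; split; lra.
rewrite !lebesgue_measure_itv/= !lte_fin.
by rewrite ltrD2r -!EFinD opprD opprK addrACA addNr addr0.
Qed.

Lemma cons_rVD d x (v : 'rV[R]_d) a b :
  cons_rV (x, v) + cons_rV (a, b) = cons_rV (x + a, v + b).
Proof.
apply/rowP => i; rewrite mxE; case: (unliftP ord0 i) => [j|] ->.
  by rewrite !cons_rVS mxE.
by rewrite !cons_rV0.
Qed.

(** Induction on the dimension: both sides define measures that agree on
    products, and a sigma-finite product measure is determined by its values on
    products. *)
Lemma lebesgue_rV_shift d (a : 'rV[R]_d) (A : set 'rV[R]_d) : measurable A ->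
  lebesgue_rV R d ((fun x => x + a) @^-1` A) = lebesgue_rV R d A.
Proof.
elim: d => [|d IH] in a A *.
  by move=> _; congr (lebesgue_rV R 0 _); apply/seteqP; split => x;
    rewrite /= (_ : x + a = x)//; apply/rowP => -[].
move=> mA; rewrite -[a]uncons_rVK; case: (uncons_rV a) => c b.
rewrite /= /lebesgue_rV_step /pushforward.
have mf : measurable_fun setT
   ((fun z => (z.1 + c, z.2 + b)) :
     measurableTypeR R * 'rV[R]_d -> measurableTypeR R * 'rV[R]_d).
  apply/measurable_fun_pairP; split.
    by apply: measurable_funD => //; exact: measurable_fst.
  exact: (measurableT_comp (measurable_shift_rV b) measurable_snd).
pose m := isMeasurableFun.Build _ _ _ _ _ mf.
pose f : {mfun (measurableTypeR R * 'rV[R]_d)%type >->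
   (measurableTypeR R * 'rV[R]_d)%type} := HB.pack (fun z => (z.1 + c, z.2 + b)) m.
transitivity (pushforward (lebesgue_measure \x lebesgue_rV R d)%E f
   (@cons_rV R d @^-1` A)).
  congr product_measure1; apply/seteqP.
  by split => -[x v] /=; rewrite cons_rVD.
apply/esym/(@product_measure_unique _ _ _ _ _ _ _
   (pushforward (lebesgue_measure \x lebesgue_rV R d)%E f)).
  move=> B C mB mC.
  transitivity ((lebesgue_measure \x lebesgue_rV R d)%E
    (((fun x => x + c) @^-1` B) `*` ((fun x => x + b) @^-1` C))) => //.
  have mB' : measurable ((fun x : measurableTypeR R => x + c) @^-1` B).
    by rewrite -[X in measurable X]setTI; exact: measurable_funD.
  have mC' : measurable ((fun x : 'rV[R]_d => x + b) @^-1` C).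
    by rewrite -[X in measurable X]setTI; exact: measurable_shift_rV.
  rewrite product_measure1E//=; congr (_ * _)%E; last exact: IH.
  exact: lebesgue_measure_shift.
by rewrite -[X in measurable X]setTI; exact: measurable_cons_rV.
Qed.

Lemma ge0_integral_shift_rV d (a : 'rV[R]_d) (f : 'rV[R]_d -> \bar R) :
  measurable_fun setT f -> (forall x, (0 <= f x)%E) ->
  (\int[lebesgue_rV R d]_x f (x + a)%R = \int[lebesgue_rV R d]_x f x)%E.
Proof.
move=> mf f0; have ma := measurable_shift_rV a.
pose m := isMeasurableFun.Build _ _ _ _ _ ma.
pose s : {mfun 'rV[R]_d >-> 'rV[R]_d} := HB.pack (fun x : 'rV[R]_d => x + a) m.
have := @ge0_integral_pushforward _ _ _ _ _ _ ma (lebesgue_rV R d) setT f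
  measurableT mf (fun x _ => f0 x).
rewrite preimage_setT => <-.
apply: (@eq_measure_integral _ _ _ _ (lebesgue_rV R d) (pushforward (lebesgue_rV R d) s)).
by move=> A mA _; exact: lebesgue_rV_shift.
Qed.

Lemma integral_shift_rV d (a : 'rV[R]_d) (f : 'rV[R]_d -> \bar R) :
  measurable_fun setT f ->
  (\int[lebesgue_rV R d]_x f (x + a)%R = \int[lebesgue_rV R d]_x f x)%E.
Proof.
move=> mf; rewrite integralE [RHS]integralE; congr (_ - _)%E.
  rewrite -[RHS](ge0_integral_shift_rV a)//; last exact: measurable_funepos.
  by apply: eq_integral => x _; rewrite !funeposE.
rewrite -[RHS](ge0_integral_shift_rV a)//; last exact: measurable_funeneg.
by apply: eq_integral => x _; rewrite !funenegE.
Qed.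

End translation.

Section cube.
Context (R : realType) (d : nat).

Lemma lebesgue_rV_cube (x : 'rV[R]_d) (r : R) : 0 < r ->
  lebesgue_rV R d [set y | `|y - x| < r] = ((2 * r) ^+ d)%:E.
Proof.
move=> r0; rewrite (_ : [set _ | _] =
   [set v : 'rV[R]_d | forall i, [set` `]x ord0 i - r, x ord0 i + r[] (v ord0 i)]); last first.
  apply/seteqP; split => y /=.
    move=> /(norm_ltP _ r0) yx i; move: (yx i); rewrite !mxE ltr_norml in_itv/=.
    by move=> /andP[? ?]; apply/andP; split; lra.
  move=> yx; apply/(norm_ltP _ r0) => i; move: (yx i); rewrite !mxE ltr_norml in_itv/=.
  by move=> /andP[? ?]; apply/andP; split; lra.
rewrite (@lebesgue_rV_box R d (fun i => [set` `]x ord0 i - r, x ord0 i + r[]))//.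
rewrite (eq_bigr (fun=> (2 * r)%:E)) => [|i _].
  by rewrite prodEFin big_const card_ord iter_mulr_1.
rewrite lebesgue_measure_itv/= lte_fin ifT; last by lra.
by rewrite -EFinD; congr EFin; lra.
Qed.

Lemma measurable_cube (x : 'rV[R]_d) (r : R) :
  measurable [set y : 'rV[R]_d | `|y - x| < r].
Proof.
apply: open_measurable_rV; rewrite (_ : [set _ | _] = ball x r).
  exact: ball_open.
by rewrite mx_norm_ball; apply/seteqP; split => y; rewrite /ball_/= distrC.
Qed.

End cube.

(** * The Euclidean norm *)

Section euclidean_norm.
Context (R : realType).

Lemma sum_enorm_ge0 m n (A : 'M[R]_(m, n)) : 0 <= \sum_i \sum_j A i j ^+ 2.
Proof. by apply: sumr_ge0 => i _; apply: sumr_ge0 => j _; exact: sqr_ge0. Qed.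

Lemma enorm_ge0 m n (A : 'M[R]_(m, n)) : 0 <= enorm A.
Proof. exact: sqrtr_ge0. Qed.

Lemma sqr_enorm m n (A : 'M[R]_(m, n)) : enorm A ^+ 2 = \sum_i \sum_j A i j ^+ 2.
Proof. by rewrite sqr_sqrtr// sum_enorm_ge0. Qed.

Lemma sqr_enorm_rV n (x : 'rV[R]_n) : enorm x ^+ 2 = \sum_j x ord0 j ^+ 2.
Proof. by rewrite sqr_enorm big_ord1. Qed.

Lemma entry_le_enorm m n (A : 'M[R]_(m, n)) i j : `|A i j| <= enorm A.
Proof.
rewrite -sqrtr_sqr; apply: ler_wsqrtr.
rewrite (bigD1 i)//= (bigD1 j)//= -addrA lerDl addr_ge0//.
  by apply: sumr_ge0 => k _; exact: sqr_ge0.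
by apply: sumr_ge0 => k _; apply: sumr_ge0 => l _; exact: sqr_ge0.
Qed.

Lemma norm_le_enorm n (x : 'rV[R]_n) : `|x| <= enorm x.
Proof. by apply/norm_leP => [|i]; [exact: enorm_ge0|exact: entry_le_enorm]. Qed.

Lemma enorm_le_norm n (x : 'rV[R]_n) : enorm x <= n%:R * `|x|.
Proof.
rewrite -(@ger0_norm _ (n%:R * `|x|)) ?mulr_ge0// -sqrtr_sqr; apply: ler_wsqrtr.
rewrite big_ord1; apply: (@le_trans _ _ (\sum_(j < n) `|x| ^+ 2)).
  apply: ler_sum => j _; rewrite -[leLHS]real_normK ?num_real//.
  by rewrite lerXn2r ?nnegrE// coord_le_norm.
rewrite big_const card_ord iter_addr_0 exprMn -[leLHS]mulr_natl ler_wpM2r ?sqr_ge0//.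
rewrite -natrX ler_nat; case: n {x} => // n.
by rewrite expnS expn1 leq_pmulr.
Qed.

Lemma enormZ m n (A : 'M[R]_(m, n)) c : enorm (c *: A) = `|c| * enorm A.
Proof.
rewrite /enorm -sqrtr_sqr -sqrtrM ?sqr_ge0//; congr Num.sqrt.
rewrite mulr_sumr; apply: eq_bigr => i _; rewrite mulr_sumr.
by apply: eq_bigr => j _; rewrite mxE exprMn.
Qed.

End euclidean_norm.

(** * Comparison of the conformal distance with the Euclidean one *)

Section conformal.
Context (R : realType) (d : nat).
Implicit Types (x y : 'rV[R]_d) (w : 'rV[R]_d -> R) (g h : R -> 'rV[R]_d).

Definition segment x y (t : R) : 'rV[R]_d := x + t *: (y - x).

Lemma is_derive_segment x y (t : R) : is_derive t (1 : R) (segment x y) (y - x).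
Proof.
have H : is_derive t (1 : R) (fun s : R => s *: (y - x)) (y - x).
  have [df dfE] := @is_diff_scalel R _ t (y - x).
  apply: DeriveDef; first exact/derivable1_diffP.
  by rewrite deriveE// dfE scale1r.
have := is_deriveD (is_derive_cst x t (1 : R)) H.
by rewrite add0r.
Qed.

Lemma C1_segment x y : C1_curve (segment x y).
Proof.
split=> [t|]; first by have [] := is_derive_segment x y t.
rewrite (_ : derive1 _ = cst (y - x)); first exact: cst_continuous.
apply/funext => t; rewrite derive1E.
by have [_ ->] := is_derive_segment x y t.
Qed.

Lemma segment_curve x y : curve_from_to x y (segment x y).
Proof.
split; last 2 first.
- by rewrite /segment scale0r addr0.
- by rewrite /segment scale1r subrKC.
exists [:: 1]; split => //=; first by rewrite andbT.
by move=> i _; exists (segment x y) => //; exact: C1_segment.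
Qed.

Lemma curve_length_ge0 w g : (forall z, 0 <= w z) -> (0 <= curve_length w g)%E.
Proof.
by move=> w0; apply: integral_ge0 => t _; rewrite lee_fin mulr_ge0// enorm_ge0.
Qed.

Lemma segment_length_le w x y W : (forall z, 0 <= w z) ->
  (forall t, 0 <= t <= 1 -> w (segment x y t) <= W) ->
  (curve_length w (segment x y) <= (W * enorm (y - x))%:E)%E.
Proof.
move=> w0 wW; rewrite /curve_length.
apply: (@le_trans _ _ (\int[lebesgue_measure]_(t in `[0%R, 1%R])
    (cst (W * enorm (y - x))%:E t))%E).
  have H t : 0 <= t <= 1 -> w (segment x y t) * enorm (derive1 (segment x y) t)
      <= W * enorm (y - x).
    move=> t01; rewrite derive1E.
    have [_ ->] := is_derive_segment x y t.
    by rewrite ler_wpM2r ?enorm_ge0// wW.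
  apply: ge0_integral_mono => t; rewrite /= in_itv/= => t01.
  - by rewrite lee_fin mulr_ge0// enorm_ge0.
  - rewrite lee_fin mulr_ge0 ?enorm_ge0//.
    exact: le_trans (w0 _) (wW _ t01).
  - by split => //; rewrite lee_fin H.
by rewrite integral_cst//= lebesgue_measure_itv/= lte01 oppr0 adde0 mule1.
Qed.

Lemma conformal_dist_le_segment w x y W : (forall z, 0 <= w z) ->
  (forall t, 0 <= t <= 1 -> w (segment x y t) <= W) ->
  conformal_dist w x y <= W * enorm (y - x).
Proof.
move=> w0 wW; rewrite /conformal_dist -lee_fin.
set S := (X in ereal_inf X).
have SW : (ereal_inf S <= (W * enorm (y - x))%:E)%E.
  apply: ge_ereal_inf; exists (curve_length w (segment x y)).
    by exists (segment x y) => //; exact: segment_curve.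
  exact: segment_length_le.
rewrite fineK// ge0_fin_numE; first exact: le_lt_trans SW (ltry _).
by apply: le_ereal_inf_tmp => _ [g _ <-]; exact: curve_length_ge0.
Qed.

Lemma conformal_dist_lt_curve w x y W r : (forall z, 0 <= w z) ->
  (forall t, 0 <= t <= 1 -> w (segment x y t) <= W) ->
  conformal_dist w x y < r ->
  exists2 g, curve_from_to x y g & (curve_length w g < r%:E)%E.
Proof.
move=> w0 wW; rewrite /conformal_dist -lte_fin.
set S := (X in ereal_inf X).
have SW : (ereal_inf S <= (W * enorm (y - x))%:E)%E.
  apply: ge_ereal_inf; exists (curve_length w (segment x y)).
    by exists (segment x y) => //; exact: segment_curve.
  exact: segment_length_le.
rewrite fineK; first by move=> /ereal_inf_lt[_ [g gxy <-] gr]; exists g.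
rewrite ge0_fin_numE; first exact: le_lt_trans SW (ltry _).
by apply: le_ereal_inf_tmp => _ [g _ <-]; exact: curve_length_ge0.
Qed.

Lemma is_derive_coord h (t : R) i : C1_curve h ->
  is_derive t (1 : R) (fun s => h s ord0 i) (derive1 h t ord0 i).
Proof.
move=> [dh _]; apply: DeriveDef; first by have /derivable_mxP := dh t.
by rewrite derive1E derive_mx// mxE.
Qed.

Lemma C1_coord_continuous h i : C1_curve h -> continuous (fun s => h s ord0 i).
Proof.
move=> Ch t; apply/differentiable_continuous/derivable1_diffP.
by have [] := is_derive_coord t i Ch.
Qed.

Lemma C1_derive_coord_continuous h i : C1_curve h ->
  continuous (fun s => derive1 h s ord0 i).
Proof.
move=> [_ ch] t.
have := @coord_continuous R 1 d ord0 i (derive1 h t).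
exact: (continuous_comp (ch t)).
Qed.

(** The fundamental theorem of calculus on one piece; the integrand is extended
    by zero so that the pieces can be added up without splitting an
    integral. *)
Lemma C1_coord_variation h (a b : R) i : a < b -> C1_curve h ->
  (`|h b ord0 i - h a ord0 i|%:E <=
   \int[lebesgue_measure]_t
     ((fun s => `|derive1 h s ord0 i|) \_ `]a, b[ t)%:E)%E.
Proof.
move=> ab Ch; pose f s := derive1 h s ord0 i.
have cf : continuous f by exact: C1_derive_coord_continuous.
have mf : measurable_fun setT (f : _ -> measurableTypeR R).
  exact: continuous_measurable_fun.
have E : (\int[lebesgue_measure]_(s in `[a, b]) (f s)%:E =
    (h b ord0 i)%:E - (h a ord0 i)%:E)%E.
  apply: (@continuous_FTC2 _ f (fun s => h s ord0 i)) => //.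
  - exact: continuous_subspaceT.
  - split => [t _||].
    + by have [] := is_derive_coord t i Ch.
    + exact/cvg_at_right_filter/C1_coord_continuous.
    + exact/cvg_at_left_filter/C1_coord_continuous.
  - by move=> t _; rewrite derive1E; have [_ ->] := is_derive_coord t i Ch.
have -> : (`|h b ord0 i - h a ord0 i|%:E =
    `| \int[lebesgue_measure]_(s in `[a, b]) (f s)%:E |)%E by rewrite E.
apply: (le_trans (le_abse_integral _ _ _)) => //.
  by apply/measurable_EFinP; exact: measurable_funS mf.
have mN : measurable_fun setT (fun s => `|f s|%:E).
  by apply/measurable_EFinP; exact: measurableT_comp.
rewrite -integral_itv_obnd_cbnd; last exact: measurable_funS mN.
rewrite -integral_itv_bndo_bndc; last exact: measurable_funS mN.
rewrite integral_mkcond; apply: ge0_integral_mono => t _.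
- by rewrite patchE; case: ifPn.
- by rewrite lee_fin patchE; case: ifPn.
- by split => //; rewrite !patchE; case: ifPn.
Qed.

Lemma derive1_eq_itv g h (a b t : R) : (forall s, a <= s <= b -> g s = h s) ->
  a < t < b -> derive1 g t = derive1 h t.
Proof.
move=> gh /andP[at_ tb]; rewrite !derive1E; apply: near_eq_derive => //.
near=> s; apply: gh; apply/andP; split; apply/ltW.
  by near: s; exact: lt_nbhsr.
by near: s; exact: lt_nbhsl.
Unshelve. all: by end_near. Qed.


(** Induction on the subdivision: the pieces contribute disjointly supported
    minorants of the speed, and only these minorants need to be
    measurable. *)
Lemma piecewise_coord_variation g i (s : seq R) (a : R) : path <%R a s ->
  (forall k, (k < size s)%N -> exists2 h, C1_curve h &
     forall t, nth 0 (a :: s) k <= t <= nth 0 s k -> g t = h t) ->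
  forall t, a <= t <= last a s -> exists q : R -> R,
    [/\ measurable_fun setT (q : _ -> measurableTypeR R), forall u, 0 <= q u,
        forall u, q u != 0 -> a < u < t /\ q u <= enorm (derive1 g u) &
        (`|g t ord0 i - g a ord0 i|%:E <= \int[lebesgue_measure]_u (q u)%:E)%E].
Proof.
have single (a' b' t : R) h : C1_curve h -> (forall u, a' <= u <= b' -> g u = h u) ->
    a' <= t <= b' -> exists q : R -> R,
    [/\ measurable_fun setT (q : _ -> measurableTypeR R), forall u, 0 <= q u,
        forall u, q u != 0 -> a' < u < t /\ q u <= enorm (derive1 g u) &
        (`|g t ord0 i - g a' ord0 i|%:E <= \int[lebesgue_measure]_u (q u)%:E)%E].
  move=> Ch gh /andP[]; rewrite le_eqVlt => /predU1P[<- _|a't tb'].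
    exists (fun=> 0); split => //; first by move=> u; rewrite eqxx.
    by rewrite subrr normr0 integral0.
  exists ((fun u => `|derive1 h u ord0 i|) \_ `]a', t[); split.
  - apply/(measurable_restrictT _ _).1 => //.
    apply: (@measurable_funS _ _ _ _ setT) => //.
    apply: measurableT_comp => //; apply: continuous_measurable_fun.
    exact: C1_derive_coord_continuous.
  - by move=> u; rewrite patchE; case: ifPn.
  - move=> u; rewrite patchE; case: ifPn => [|]; last by rewrite eqxx.
    rewrite inE/= in_itv/= => /[dup] a'ut /andP[a'u ut] _; split => //.
    rewrite (@derive1_eq_itv g h a' b') ?entry_le_enorm//.
    by rewrite a'u (lt_le_trans ut).
  - rewrite !gh ?(ltW a't)//; last by rewrite lexx (le_trans (ltW a't)).
    exact: C1_coord_variation.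
elim: s a => [|b s IH] a /=.
  move=> _ _ t; rewrite -eq_le => /eqP <-; exists (fun=> 0); split => //.
    by move=> u; rewrite eqxx.
  by rewrite subrr normr0 integral0.
move=> /andP[ab bs] gs t /andP[at_ tl].
have [h0 Ch0 gh0] := gs 0%N isT.
have [tb|bt] := leP t b.
  by apply: (single a b t h0) => //; rewrite at_ tb.
have [//|q0 [mq0 q00 q0s Hq0]] := single a b b h0 Ch0 gh0; first by rewrite lexx ltW.
have [//||q1 [mq1 q10 q1s Hq1]] := IH b bs _ t.
  by move=> k ks; have [h Ch gh] := gs k.+1 ks; exists h.
  by rewrite (ltW bt).
exists (fun u => q0 u + q1 u); split.
- exact: measurable_funD.
- by move=> u; rewrite addr_ge0.
- move=> u; have [Q0|/q0s[/andP[au ub] q0u]] := eqVneq (q0 u) 0.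
    rewrite Q0 add0r => /q1s[/andP[bu ut] q1u]; split => //.
    by rewrite (lt_trans ab bu).
  have [Q1|/q1s[/andP[bu _]]] := eqVneq (q1 u) 0.
    by move=> _; rewrite Q1 addr0 au (lt_trans ub bt).
  by move: (lt_trans bu ub); rewrite ltxx.
- under eq_integral do rewrite EFinD.
  rewrite ge0_integralD//; try by apply/measurable_EFinP.
    apply: (le_trans _ (leeD Hq0 Hq1)); rewrite -EFinD lee_fin.
    have -> : g t ord0 i - g a ord0 i =
      (g b ord0 i - g a ord0 i) + (g t ord0 i - g b ord0 i) by ring.
    exact: ler_normD.
  all: by move=> u _; rewrite lee_fin.
Qed.

Lemma coord_variation_le w g m : piecewise_C1 g -> 0 <= m ->
  (forall t, 0 <= t <= 1 -> m <= w (g t)) ->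
  (forall z, 0 <= w z) ->
  forall t i, 0 <= t <= 1 ->
    ((m * `|g t ord0 i - g 0 ord0 i|)%:E <= curve_length w g)%E.
Proof.
move=> [s [ps s1 gs]] m0 mw w0 t i t01.
have [|q [mq q0 qs Hq]] := @piecewise_coord_variation g i s 0 ps gs t.
  by rewrite s1.
apply: (@le_trans _ _ (\int[lebesgue_measure]_u (m%:E * (q u)%:E))%E).
  rewrite ge0_integralZl//; last 2 first.
  - by apply/measurable_EFinP.
  - by move=> u _; rewrite lee_fin.
  by rewrite EFinM; apply: lee_wpmul2l.
rewrite /curve_length [leRHS]integral_mkcond.
apply: ge0_integral_mono => u _.
- by apply: mule_ge0; rewrite lee_fin.
- by rewrite patchE; case: ifPn => // _; rewrite lee_fin mulr_ge0// enorm_ge0.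
split => //; rewrite patchE; have [->|/qs[/andP[u0 ut] qu]] := eqVneq (q u) 0.
  by rewrite mule0; case: ifPn => // _; rewrite lee_fin mulr_ge0// enorm_ge0.
have u01 : 0 <= u <= 1.
  by rewrite (ltW u0)/=; move/andP: t01 => [_]; apply: le_trans (ltW ut).
rewrite ifT; last by rewrite inE/= in_itv.
by rewrite -EFinM lee_fin ler_pM// mw.
Qed.

(** A weight at least 1 makes the conformal distance dominate the Euclidean
    one, so a curve of length less than [b] stays in a Euclidean ball on which
    the weight is comparable with its value at the centre; the distance is
    then bounded below by that value times the Euclidean one. *)
Lemma norm_le_conformal_dist w x y (b r m W : R) :
  (forall z, 1 <= w z) -> 0 <= m ->
  (forall t, 0 <= t <= 1 -> w (segment x y t) <= W) ->
  (forall z, `|z - x| <= b -> m <= w z) ->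
  0 <= r -> r <= b -> conformal_dist w x y < r -> `|y - x| <= r /\ m * `|y - x| <= r.
Proof.
move=> w1 m0 wW mw r0 rb.
have w0 z : 0 <= w z by apply: le_trans (w1 z).
move=> /(conformal_dist_lt_curve w0 wW)[g [pg g0 g1] /ltW gr].
have near_x t : 0 <= t <= 1 -> `|g t - x| <= r.
  move=> t01; apply/norm_leP => // i; rewrite !mxE -lee_fin -g0 -[X in (X%:E <= _)%E]mul1r.
  by apply: le_trans gr; apply: coord_variation_le.
have i01 : (0 <= 1 :> R) && (1 <= 1 :> R) by rewrite lexx ler01.
split; first by rewrite -g1; exact: near_x.
have [->|m_gt0] : m = 0 \/ 0 < m by move: m0; rewrite le_eqVlt => /orP[/eqP|]; auto.
  by rewrite mul0r.
rewrite mulrC -ler_pdivlMr//; apply/norm_leP => [|i]; first by rewrite divr_ge0.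
rewrite ler_pdivlMr// mulrC !mxE -lee_fin -g0 -g1.
apply: le_trans gr; apply: coord_variation_le => // t t01.
by apply: mw; apply: (le_trans (near_x t t01)).
Qed.

End conformal.

(** * Derivatives along lines *)

Section lines.
Context (R : realType) (V : normedModType R).
Implicit Types (f : V -> R) (x v : V).

Lemma is_derive_line f x v (t : R) (df : R) :
  is_derive (x + t *: v) v f df ->
  is_derive t (1 : R) (fun s : R => f (x + s *: v)) df.
Proof.
have E : (fun h : R => h^-1 *: (((fun s : R => f (x + s *: v)) \o shift t) (h *: (1 : R)) -
    f (x + t *: v))) =
  (fun h : R => h^-1 *: ((f \o shift (x + t *: v)) (h *: v) - f (x + t *: v))).
  apply/funext => h /=; congr (_ *: (f _ - _)).
  by rewrite [h *: 1]mulr1 scalerDl addrCA addrC -addrA.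
by move=> [dfx dfE]; apply: DeriveDef; [rewrite /derivable E|rewrite -dfE /derive E].
Qed.

Lemma line_mean_value f (df : V -> R) x v (t : R) : 0 <= t ->
  (forall s, 0 <= s <= t -> is_derive (x + s *: v) v f (df (x + s *: v))) ->
  exists2 s, 0 <= s <= t & f (x + t *: v) - f x = df (x + s *: v) * t.
Proof.
move=> t0 fdf.
have cf : {within `[0, t], continuous (fun s : R => f (x + s *: v))}.
  apply: derivable_within_continuous => s; rewrite in_itv/= => s0t.
  by have [] := is_derive_line (fdf s s0t).
have [|s] := @MVT_segment R (fun s => f (x + s *: v)) (fun s => df (x + s *: v)) 0 t t0 _ cf.
  move=> s; rewrite in_itv/= => /andP[s0 st]; apply/is_derive_line/fdf.
  by rewrite !ltW.
by rewrite in_itv/= scale0r addr0 subr0 => s0t ->; exists s.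
Qed.

Lemma backward_quotient_cvg f x v (df : R) (t : R^nat) :
  (forall n, 0 < t n) -> t @ \oo --> 0 -> is_derive x v f df ->
  (fun n => (f x - f (x - t n *: v)) / t n) @ \oo --> df.
Proof.
move=> t0 tcvg [dfx dfE].
have := dfx; rewrite /derivable => /cvg_ex[l Hl].
have lE : l = df by rewrite -dfE; apply/esym/cvg_lim.
have H0 : (fun n => - t n) @ \oo --> 0^'.
  move=> P [e /= e0 eP].
  suff : \forall n \near \oo, P (- t n) by [].
  move/cvgrPdist_lt : tcvg => /(_ e e0); apply: filterS => n.
  rewrite sub0r normrN => tne; apply: eP => /=; last by rewrite oppr_eq0 gt_eqF.
  by rewrite sub0r opprK.
have := cvg_comp _ _ H0 Hl; rewrite -lE; apply: cvg_trans.
apply: near_eq_cvg; apply: nearW => n /=.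
rewrite scaleNr [- _ + x]addrC invrN.
by rewrite [LHS]mulNr -mulrN opprB mulrC.
Qed.

End lines.

(** * Isoperimetry from a vector field *)

Section bounded_support.
Context (R : realType) (d : nat).

Lemma integrable_bounded_support (u : 'rV[R]_d -> R) N M : 0 < N ->
  measurable_fun setT (u : _ -> measurableTypeR R) ->
  (forall x, `|u x| <= M) -> (forall x, N <= `|x| -> u x = 0) ->
  (lebesgue_rV R d).-integrable setT (EFin \o u).
Proof.
move=> N0 mu uM u0; pose Q : set 'rV[R]_d := [set y | `|y - 0| < N].
have mQ : measurable Q by exact: measurable_cube.
rewrite (_ : EFin \o u = (EFin \o u) \_ Q); last first.
  apply/funext => x; rewrite /= patchE; case: ifPn => // /negP xQ.
  rewrite /= u0// leNgt; apply/negP => xN; apply: xQ.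
  by rewrite inE /Q/= subr0.
apply/(integrable_mkcond _ mQ); apply: measurable_bounded_integrable => //.
- by rewrite [ltLHS](lebesgue_rV_cube 0 N0) ltry.
- exact: measurable_funS mu.
- by exists M; split; rewrite ?num_real// => M' /ltW MM' x _; exact: le_trans MM'.
Qed.

End bounded_support.

Section cutoff.
Context (R : realType) (d : nat).
Variables (w : 'rV[R]_d -> R) (A : set 'rV[R]_d) (K Cw : R) (y0 : 'rV[R]_d).
Hypothesis w1 : forall x, 1 <= w x.
Hypothesis K1 : 1 <= K.
Hypothesis Cw1 : 1 <= Cw.
Hypothesis wCw : forall x y, `|x - y| <= 1 -> w x <= Cw * w y.
Hypothesis y0A : ~ A y0.

(** Plays the role of the distance to the complement of [A] in the metric
    [w |dx|], multiplied by [K] and truncated at 1. With the weight taken at the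
    far end it is an infimum of explicit Lipschitz functions, whose constants
    are comparable to [w x] because far points are cut off by the truncation. *)
Definition cutoff (x : 'rV[R]_d) : R :=
  inf [set Num.min 1 (K * w y * `|x - y|) | y in ~` A].

Let S x := [set Num.min 1 (K * w y * `|x - y|) | y in ~` A].

Let K0 : 0 <= K. Proof. exact: le_trans K1. Qed.
Let w0 x : 0 <= w x. Proof. by apply: le_trans (w1 x). Qed.
Let Cw0 : 0 <= Cw. Proof. exact: le_trans Cw1. Qed.

Let Slb x : lbound (S x) 0.
Proof. by move=> _ [y _ <-]; rewrite le_min ler01 !mulr_ge0. Qed.

Let Sinf x : has_inf (S x).
Proof. by split; [exists (Num.min 1 (K * w y0 * `|x - y0|)), y0|exists 0]. Qed.

Lemma cutoff_ge0 x : 0 <= cutoff x.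
Proof. by apply: lb_le_inf; [have [] := Sinf x|exact: Slb]. Qed.

Lemma cutoff_le x y : ~ A y -> cutoff x <= Num.min 1 (K * w y * `|x - y|).
Proof. by move=> Ay; apply: ge_inf; [have [] := Sinf x|exists y]. Qed.

Lemma cutoff_le1 x : cutoff x <= 1.
Proof. by apply: le_trans (cutoff_le x y0A) _; rewrite ge_min lexx. Qed.

Lemma cutoff_out x : ~ A x -> cutoff x = 0.
Proof.
move=> Ax; apply/eqP; rewrite eq_le cutoff_ge0 andbT.
apply: le_trans (cutoff_le x Ax) _.
by rewrite ge_min subrr normr0 mulr0 lexx orbT.
Qed.

Lemma cutoff_lt1 x : cutoff x < 1 -> exists2 y, ~ A y & K * w y * `|x - y| < 1.
Proof.
move=> /inf_lt -/(_ (proj1 (Sinf x)))[_ [y Ay <-]]; rewrite gt_min ltxx/= => ?.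
by exists y.
Qed.

Let lip_half x z r : `|x - z| <= 1 -> (forall y, `|z - y| <= 1 -> w y <= r) ->
  cutoff x <= cutoff z + K * r * `|x - z|.
Proof.
move=> xz wr; rewrite -lerBlDr; apply: lb_le_inf; first by have [] := Sinf z.
move=> _ [y Ay <-]; rewrite lerBlDr; apply: le_trans (cutoff_le x Ay) _.
have r0 : 0 <= r by apply: le_trans (w0 z) _; apply: wr; rewrite subrr normr0.
have kr0 : 0 <= K * r * `|x - z| by rewrite !mulr_ge0.
have [h|h] := leP 1 (K * w y * `|z - y|).
  by rewrite ge_min lerDl kr0.
have zy : `|z - y| <= 1.
  apply: le_trans (ltW h); rewrite -[leLHS]mul1r ler_wpM2r//.
  by rewrite -[leLHS]mul1r ler_pM.
rewrite ge_min; apply/orP; right.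
apply: (@le_trans _ _ (K * w y * (`|z - y| + `|x - z|))).
  by rewrite ler_wpM2l ?mulr_ge0// [leRHS]addrC ler_distD.
by rewrite mulrDr lerD2l ler_wpM2r// ler_wpM2l// wr.
Qed.

Lemma cutoff_lipschitz x z : `|x - z| <= 1 ->
  `|cutoff x - cutoff z| <= K * Cw ^+ 2 * w x * `|x - z|.
Proof.
move=> xz.
have h1 : cutoff x <= cutoff z + K * (Cw ^+ 2 * w x) * `|x - z|.
  apply: lip_half => // y zy; apply: (@le_trans _ _ (Cw * w z)).
    by rewrite wCw// distrC.
  by rewrite expr2 -mulrA ler_wpM2l// wCw// distrC.
have h2 : cutoff z <= cutoff x + K * (Cw ^+ 2 * w x) * `|x - z|.
  rewrite distrC; apply: lip_half => [|y xy]; first by rewrite distrC.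
  apply: (@le_trans _ _ (Cw * w x)); first by rewrite wCw// distrC.
  by rewrite ler_wpM2r// expr2 ler_peMl.
by rewrite ler_norml -[K * _ * _]mulrA; apply/andP; split; lra.
Qed.

Lemma near_norm_lt (x : 'rV[R]_d) e : 0 < e -> \forall z \near x, `|x - z| < e.
Proof.
by move=> e0; apply/nbhs_ballP; exists e => // z; rewrite mx_norm_ball.
Qed.

Lemma cutoff_continuous : continuous cutoff.
Proof.
move=> x; apply/(@cvgrPdist_lt _ _ _ (nbhs x) (nbhs_filter x)) => e e0.
pose r := K * Cw ^+ 2 * w x + 1.
have r0 : 0 < r by rewrite ltr_wpDl// !mulr_ge0// sqr_ge0.
apply: filterS2 (near_norm_lt x ltr01) (near_norm_lt x (divr_gt0 e0 r0)).
move=> z /ltW xz xzr; apply: le_lt_trans (cutoff_lipschitz xz) _.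
apply: (@le_lt_trans _ _ (r * `|x - z|)).
  by rewrite ler_wpM2r// /r lerDl.
by rewrite mulrC -ltr_pdivlMr.
Qed.

End cutoff.

Section vector_field.
Context (R : realType) (d : nat).
Variables (w p : 'rV[R]_d -> R) (K Cw Cp CG c N W M : R).
Variables (G DG : 'I_d -> 'rV[R]_d -> R) (A : set 'rV[R]_d) (y0 : 'rV[R]_d).
Hypothesis w1 : forall x, 1 <= w x.
Hypothesis K1 : 1 <= K.
Hypothesis Cw1 : 1 <= Cw.
Hypothesis wCw : forall x y, `|x - y| <= 1 -> w x <= Cw * w y.
Hypothesis p0 : forall x, 0 < p x.
Hypothesis cp : continuous p.
Hypothesis pCp : forall x y, w x * `|x - y| <= 1 -> p y <= Cp * p x.
Hypothesis cG : forall j, continuous (G j).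
Hypothesis dG : forall j x, is_derive x (delta_mx ord0 j) (G j) (DG j x).
Hypothesis Gle : forall j x, `|G j x| * w x <= CG * p x.
Hypothesis oA : open A.
Hypothesis AN : forall x, A x -> `|x| <= N.
Hypothesis y0A : ~ A y0.
Hypothesis N0 : 0 <= N.
Hypothesis pM : forall x, `|x| <= N + 1 -> p x <= M.
Hypothesis wW : forall x, `|x| <= N + 1 -> w x <= W.
Hypothesis DGM : forall j x, `|x| <= N + 1 -> `|DG j x| <= M.
Hypothesis c0 : 0 < c.
Hypothesis divG : forall x, A x -> c * p x <= \sum_j DG j x.

Let f := cutoff w A K.
Let L := K * Cw ^+ 2.
Let layer : set 'rV[R]_d := A `&` [set x | f x < 1].
Let mu (B : set 'rV[R]_d) : \bar R :=
  (\int[lebesgue_rV R d]_(x in B) (p x)%:E)%E.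
Let e j : 'rV[R]_d := delta_mx ord0 j.
Let pl x := if x \in layer then p x else 0.

Let w0 x : 0 < w x. Proof. exact: lt_le_trans (w1 x). Qed.
Let K0 : 0 <= K. Proof. exact: le_trans K1. Qed.
Let L0 : 0 <= L. Proof. by rewrite mulr_ge0// sqr_ge0. Qed.
Let f0 x : 0 <= f x. Proof. exact: (@cutoff_ge0 R d w A K y0). Qed.
Let f1 x : f x <= 1. Proof. exact: (@cutoff_le1 R d w A K y0). Qed.
Let fout x : ~ A x -> f x = 0. Proof. exact: (@cutoff_out R d w A K y0). Qed.

Let mf : measurable_fun setT (f : _ -> measurableTypeR R).
Proof. by apply: continuous_measurable_rV; apply: (@cutoff_continuous R d w A K Cw y0). Qed.

Let mA : measurable A. Proof. exact: open_measurable_rV. Qed.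

Let mlayer : measurable layer.
Proof.
apply: measurableI => //; rewrite -[X in measurable X]setTI.
rewrite (_ : [set x | _] = f @^-1` [set` `]-oo, 1[]); first exact: mf.
by apply/seteqP; split => x /=; rewrite in_itv.
Qed.

Let mp : measurable_fun setT (p : _ -> measurableTypeR R).
Proof. exact: continuous_measurable_rV. Qed.

Let mG j : measurable_fun setT (G j : _ -> measurableTypeR R).
Proof. exact: continuous_measurable_rV. Qed.

Let pl0 x : 0 <= pl x. Proof. by rewrite /pl; case: ifPn => // _; exact: ltW. Qed.

Let plE : (fun x => (pl x)%:E) = ((EFin \o p) \_ layer)%E.
Proof. by apply/funext => x; rewrite /pl patchE; case: ifPn. Qed.

Let mpl : measurable_fun setT (fun x => (pl x)%:E).
Proof.
rewrite plE; apply/(measurable_restrictT _ _).1 => //.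
apply/measurable_EFinP; exact: measurable_funS mp.
Qed.

Let int_pl : (\int[lebesgue_rV R d]_x (pl x)%:E = mu layer)%E.
Proof. by rewrite /mu [RHS]integral_mkcond -[in RHS]/(EFin \o p) -plE. Qed.

Let norm_e j : `|e j| <= 1.
Proof.
apply/norm_leP => // i; rewrite mxE eqxx/=.
by case: eqP => _; rewrite ?normr1 ?normr0.
Qed.

Let norm_te j t : 0 <= t -> `|t *: e j| <= t.
Proof. by move=> t0; rewrite normrZ ger0_norm// ler_piMr. Qed.

(** Only points of the layer see the cutoff vary: for a step [t] too small for
    the cutoff to jump from 0 to 1, one end of the step lies in the layer. *)
Let step_bound j t x : 0 < t -> t <= 1 -> L * W * t < 1 -> W * t <= 1 ->
  `|(f x - f (x + t *: e j)) * G j x| <=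
  t * (L * CG) * (pl x + Cp * pl (x + t *: e j)).
Proof.
move=> t0 t1 LWt Wt; set z := x + t *: e j.
have xz : `|x - z| <= t by rewrite /z opprD addrA subrr sub0r normrN norm_te// ltW.
have fxz : `|f x - f z| <= L * w x * t.
  apply: le_trans (@cutoff_lipschitz R d w A K Cw y0 _ _ _ _ _ x z _) _ => //.
    exact: le_trans t1.
  by rewrite ler_wpM2l// mulr_ge0// ltW.
have LCG : 0 <= t * (L * CG) * p x.
  rewrite -mulrA mulr_ge0 ?(ltW t0)// -mulrA mulr_ge0//.
  by apply: le_trans (Gle j x); rewrite mulr_ge0// ltW.
have CG0 : 0 <= CG.
  have : 0 <= CG * p x by apply: le_trans (Gle j x); rewrite mulr_ge0// ltW.
  by rewrite pmulr_lge0.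
have tLCG : 0 <= t * (L * CG).
  by apply: mulr_ge0; [exact: ltW|exact: mulr_ge0 L0 CG0].
have key : `|(f x - f z) * G j x| <= t * (L * CG) * p x.
  rewrite normrM; apply: (@le_trans _ _ (L * w x * t * `|G j x|)).
    by rewrite ler_wpM2r.
  rewrite (_ : L * _ * t * _ = t * L * (`|G j x| * w x)); last by ring.
  rewrite (_ : t * (L * CG) * _ = t * L * (CG * p x)); last by ring.
  by rewrite ler_wpM2l// mulr_ge0// ltW.
have Cp0 : 0 <= Cp.
  have : p x <= Cp * p x by apply: pCp; rewrite subrr normr0 mulr0.
  move=> /(lt_le_trans (p0 x)).
  by rewrite pmulr_lgt0// => /ltW.
have [xl|xl] := pselect (layer x).
  apply: (le_trans key); rewrite {1}/pl mem_set//=.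
  apply: ler_wpM2l => //.
  by rewrite lerDl mulr_ge0.
have [zl|zl] := pselect (layer z).
  apply: (le_trans key); rewrite {2}/pl mem_set//=.
  apply: ler_wpM2l => //.
  apply: ler_wpDl => //; apply: pCp.
  rewrite distrC; apply: le_trans Wt; apply: ler_pM => //; first exact: ltW.
  by apply: wW; apply: le_trans (AN zl.1) _; rewrite lerDl.
suff -> : f x = f z.
  rewrite subrr mul0r normr0; apply: mulr_ge0 => //; apply: addr_ge0 => //.
  exact: mulr_ge0.
have fl u : ~ layer u -> (A u /\ f u = 1) \/ (~ A u /\ f u = 0).
  move=> ul; have [Au|Au] := pselect (A u); last by right; rewrite fout.
  left; split => //; apply/eqP; rewrite eq_le f1/= leNgt; apply/negP => fu.
  exact: ul.
have far : ~ (1 <= L * w x * t) \/ ~ `|x| <= N + 1.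
  have [xN|] := pselect (`|x| <= N + 1); last by right.
  left; apply/negP; rewrite -ltNge; apply: le_lt_trans LWt.
  by rewrite ler_wpM2r ?(ltW t0)// ler_wpM2l// wW.
have [[Ax fx]|[Ax fx]] := fl _ xl; have [[Az fz]|[Az fz]] := fl _ zl;
  rewrite ?fx ?fz//.
- exfalso; move: fxz; rewrite fx fz subr0 normr1 => fxz.
  case: far => //; apply; apply: le_trans (AN Ax) _.
  by rewrite lerDl.
- exfalso; move: fxz; rewrite fx fz sub0r normrN normr1 => fxz.
  case: far => //; apply.
  rewrite -[x](subrK z); apply: (le_trans (ler_normD _ _)).
  rewrite addrC lerD//; [exact: AN|exact: le_trans t1].
Qed.

Let M0 : 0 <= M.
Proof. by apply: le_trans (ltW (p0 0)) _; rewrite pM// normr0 addr_ge0. Qed.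

Let CG0 (j : 'I_d) : 0 <= CG.
Proof.
have : 0 <= CG * p 0 by apply: le_trans (Gle j 0); rewrite mulr_ge0// ltW.
by rewrite pmulr_lge0.
Qed.

Let GM j x : `|x| <= N + 1 -> `|G j x| <= CG * M.
Proof.
move=> xN; apply: (@le_trans _ _ (CG * p x)); last first.
  by apply: ler_wpM2l; [exact: CG0|exact: pM].
by apply: le_trans (Gle j x); rewrite ler_peMr.
Qed.

Let Q0 : 0 < N + 3 :> R. Proof. by rewrite ltr_wpDl. Qed.

Let shift_near j t x : 0 < t -> t <= 1 ->
  (`|x + t *: e j| <= `|x| + 1) * (`|x| <= `|x + t *: e j| + 1) *
  (`|x - t *: e j| <= `|x| + 1).
Proof.
move=> t0 t1; have te : `|t *: e j| <= 1 by apply: le_trans t1; rewrite norm_te// ltW.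
split; [split|].
- by apply: le_trans (ler_normD _ _) _; rewrite lerD2l.
- rewrite -{1}[x](addrK (t *: e j)); apply: le_trans (ler_normB _ _) _.
  by rewrite lerD2l.
- by apply: le_trans (ler_normB _ _) _; rewrite lerD2l.
Qed.

Let f_far x : N < `|x| -> f x = 0.
Proof. by move=> xN; apply: fout => /AN; rewrite leNgt xN. Qed.

Let measurable_fun_shift (u : 'rV[R]_d -> R) a :
  measurable_fun setT (u : _ -> measurableTypeR R) ->
  measurable_fun setT ((fun x => u (x + a)) : _ -> measurableTypeR R).
Proof. by move=> mu'; exact: (measurableT_comp mu' (measurable_shift_rV a)). Qed.

Let int_fG j : (lebesgue_rV R d).-integrable setT (EFin \o (fun x => f x * G j x)).
Proof.
apply: (@integrable_bounded_support R d _ (N + 3) (CG * M)) => //.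
- exact: (measurable_funM mf (mG j)).
- move=> x; have [xN|xN] := leP `|x| N; last first.
    by rewrite f_far// mul0r normr0 mulr_ge0// (CG0 j).
  rewrite normrM ger0_norm// -[leRHS]mul1r ler_pM// GM//.
  by apply: le_trans xN _; rewrite lerDl.
- move=> x xN; rewrite f_far ?mul0r//; apply: lt_le_trans xN.
  by rewrite ltrDl.
Qed.

Let int_fGm j t : 0 < t -> t <= 1 ->
  (lebesgue_rV R d).-integrable setT (EFin \o (fun x => f x * G j (x - t *: e j))).
Proof.
move=> t0 t1; apply: (@integrable_bounded_support R d _ (N + 3) (CG * M)) => //.
- exact: (measurable_funM mf (measurable_fun_shift (- (t *: e j)) (mG j))).
- move=> x; have [xN|xN] := leP `|x| N; last first.
    by rewrite f_far// mul0r normr0 mulr_ge0// (CG0 j).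
  rewrite normrM ger0_norm// -[leRHS]mul1r ler_pM// GM//.
  by apply: le_trans (shift_near j x t0 t1).2 _; rewrite lerD2r.
- move=> x xN; rewrite f_far ?mul0r//; apply: lt_le_trans xN.
  by rewrite ltrDl.
Qed.

Let int_fGp j t : 0 < t -> t <= 1 ->
  (lebesgue_rV R d).-integrable setT (EFin \o (fun x => f (x + t *: e j) * G j x)).
Proof.
move=> t0 t1; apply: (@integrable_bounded_support R d _ (N + 3) (CG * M)) => //.
- exact: (measurable_funM (measurable_fun_shift (t *: e j) mf) (mG j)).
- move=> x; have [xN|xN] := leP `|x + t *: e j| N; last first.
    by rewrite f_far// mul0r normr0 mulr_ge0// (CG0 j).
  rewrite normrM ger0_norm// -[leRHS]mul1r ler_pM// GM//.
  by apply: le_trans (shift_near j x t0 t1).1.2 _; rewrite lerD2r.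
- move=> x xN; rewrite f_far ?mul0r//.
  by have := (shift_near j x t0 t1).1.2; lra.
Qed.

Let pl_far x : N < `|x| -> pl x = 0.
Proof.
move=> xN; rewrite /pl; case: ifPn => // /set_mem[/AN].
by rewrite leNgt xN.
Qed.

Let mplr : measurable_fun setT (pl : _ -> measurableTypeR R).
Proof. exact/measurable_EFinP. Qed.

Let pl_le x : `|pl x| <= M.
Proof.
rewrite ger0_norm// /pl; case: ifPn => // /set_mem[/AN xN _].
by apply: pM; apply: le_trans xN _; rewrite lerDl.
Qed.

Let int_pl0 : (lebesgue_rV R d).-integrable setT (EFin \o pl).
Proof.
apply: (@integrable_bounded_support R d _ (N + 3) M) => //.
by move=> x xN; rewrite pl_far//; apply: lt_le_trans xN; rewrite ltrDl.
Qed.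

Let int_plp j t : 0 < t -> t <= 1 ->
  (lebesgue_rV R d).-integrable setT (EFin \o (fun x => pl (x + t *: e j))).
Proof.
move=> t0 t1; apply: (@integrable_bounded_support R d _ (N + 3) M) => //.
  exact: measurable_fun_shift.
by move=> x xN; rewrite pl_far//; have := (shift_near j x t0 t1).1.2; lra.
Qed.

Let m := fine (mu layer).

Let mE : mu layer = m%:E.
Proof. by rewrite /m fineK// -int_pl; exact: integrable_fin_num int_pl0. Qed.

(** Discrete integration by parts: translation invariance moves the difference
    quotient from the field to the cutoff, where [step_bound] applies. *)
Let step_integral j t : 0 < t -> t <= 1 -> L * W * t < 1 -> W * t <= 1 ->
  (\int[lebesgue_rV R d]_x (f x * (G j x - G j (x - t *: e j)))%:E <=
   (t * (L * CG) * (1 + Cp) * m)%:E)%E.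
Proof.
move=> t0 t1 LWt Wt.
have -> : (\int[lebesgue_rV R d]_x (f x * (G j x - G j (x - t *: e j)))%:E =
   \int[lebesgue_rV R d]_x ((f x - f (x + t *: e j)) * G j x)%:E)%E.
  under eq_integral do rewrite mulrBr EFinB.
  under [RHS]eq_integral do rewrite mulrBl EFinB.
  rewrite integralB_EFin//; last exact: int_fGm.
  rewrite integralB_EFin//; last exact: int_fGp.
  congr (_ - _)%E.
  rewrite -(integral_shift_rV (t *: e j)); last first.
    by have /integrableP[] := int_fGm j t0 t1.
  by apply: eq_integral => x _; rewrite addrK.
apply: (@le_trans _ _ (\int[lebesgue_rV R d]_x
   ((t * (L * CG))%:E * ((pl x)%:E + Cp%:E * (pl (x + t *: e j))%:E)))%E).
  have i2 : (lebesgue_rV R d).-integrable setT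
     (fun x => (Cp%:E * (pl (x + t *: e j))%:E)%E).
    by apply: integrableZl => //; exact: int_plp.
  apply: le_integral => //.
  - under [X in integrable _ _ X]eq_fun do rewrite mulrBl EFinB.
    exact: (integrableB measurableT (int_fG j) (int_fGp j t0 t1)).
  - apply: integrableZl => //; exact: integrableD.
  - move=> x _; rewrite -[(Cp%:E * _)%E]EFinM -EFinD -EFinM lee_fin.
    by apply: le_trans (step_bound j x t0 t1 LWt Wt); exact: ler_norm.
rewrite integralZl//; last first.
  by apply: integrableD => //; apply: integrableZl => //; exact: int_plp.
rewrite integralD//; last by apply: integrableZl => //; exact: int_plp.
rewrite integralZl//; last exact: int_plp.
rewrite (@integral_shift_rV R d (t *: e j) (EFin \o pl))// int_pl mE.
rewrite -[(Cp%:E * _)%E]EFinM -EFinD -EFinM lee_fin.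
by rewrite (_ : _ * (m + _) = t * (L * CG) * (1 + Cp) * m)//; ring.
Qed.

Let quot j t x := f x * ((G j x - G j (x - t *: e j)) / t).

Let quot_bound j t x : 0 < t -> t <= 1 -> `|quot j t x| <= M.
Proof.
move=> t0 t1; rewrite /quot; have [xN|xN] := leP `|x| N; last first.
  by rewrite f_far// mul0r normr0.
have [s /andP[s0 st] E] := @line_mean_value _ _ (G j) (DG j) (x - t *: e j) (e j) t
  (ltW t0) (fun s _ => dG j _).
move: E; rewrite subrK => ->; rewrite mulfK ?gt_eqF//.
rewrite normrM ger0_norm// -[leRHS]mul1r ler_pM// DGM//.
rewrite (_ : x - _ + _ = x - (t - s) *: e j); last first.
  by rewrite scalerBl opprB addrCA addrC.
apply: le_trans (ler_normB _ _) _.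
apply: lerD => //; apply: (@le_trans _ _ (t - s)); last by lra.
by rewrite norm_te// subr_ge0.
Qed.

(** The denominator makes every smallness condition of [step_bound] hold for
    all [n]. *)
Let t_ n : R := (n.+1%:R)^-1 / (1 + L * W + W).

Let W0 : 1 <= W.
Proof. by apply: le_trans (w1 0) _; apply: wW; rewrite normr0 addr_ge0. Qed.

Let LW0 : 0 <= L * W. Proof. by apply: mulr_ge0 => //; exact: le_trans W0. Qed.

Let t_small n : [/\ 0 < t_ n, t_ n <= 1, L * W * t_ n < 1 & W * t_ n <= 1].
Proof.
have D0 : 0 < 1 + L * W + W by move: LW0 W0; lra.
have n1 : (n.+1%:R : R)^-1 <= 1 by rewrite invf_le1// ler1n.
have tn0 : 0 < t_ n by rewrite /t_ divr_gt0.
have tD : t_ n * (1 + L * W + W) <= 1 by rewrite /t_ divfK// gt_eqF.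
have W00 : 0 <= W by apply: le_trans W0.
have a1 : 0 <= L * W * t_ n by apply: mulr_ge0 => //; exact: ltW.
have a2 : 0 <= W * t_ n by apply: mulr_ge0 => //; exact: ltW.
move: tD; rewrite mulrC !mulrDl mul1r => tD.
by split => //; lra.
Qed.

Let t_cvg : t_ @ \oo --> 0.
Proof.
rewrite -[X in _ --> X](mul0r (1 + L * W + W)^-1); apply: cvgMl.
exact: cvg_harmonic.
Qed.

Let flux x := f x * \sum_j DG j x.

Let mquot j t : measurable_fun setT (quot j t : _ -> measurableTypeR R).
Proof.
apply: (measurable_funM mf); apply: measurable_funM => //.
exact: (measurable_funB (mG j) (measurable_fun_shift (- (t *: e j)) (mG j))).
Qed.

Let msum_quot n :
  measurable_fun setT ((fun x => \sum_j quot j (t_ n) x) : _ -> measurableTypeR R).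
Proof.
by apply: measurable_sum => j; exact: mquot.
Qed.

Let quot_cvg x : (fun n => \sum_j quot j (t_ n) x) @ \oo --> flux x.
Proof.
rewrite /flux mulr_sumr; apply: cvg_big => [|j _]; first exact: add_continuous.
apply: cvgMr.
apply: backward_quotient_cvg => //.
by move=> n; have [] := t_small n.
Qed.

(** The divergence theorem, with the term containing the derivatives of the
    cutoff already estimated: dominated convergence in [step_integral]. *)
Let flux_integral_le :
  (\int[lebesgue_rV R d]_x (flux x)%:E <=
   (d%:R * ((L * CG) * (1 + Cp) * m))%:E)%E.
Proof.
pose B := d%:R * M.
pose Q : set 'rV[R]_d := [set y | `|y - 0| < N + 3].
have mQ : measurable Q by exact: measurable_cube.
have B0 : 0 <= B by rewrite mulr_ge0.
have intB : (lebesgue_rV R d).-integrable setT (EFin \o (fun x => B * \1_Q x)).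
  apply: (@integrable_bounded_support R d _ (N + 3) B) => //.
  - by apply: measurable_funM => //; exact: measurable_indic.
  - move=> x; rewrite normrM ger0_norm// ler_piMr// indicE.
    by case: (_ \in _); rewrite ?normr1 ?normr0.
  - move=> x xN; rewrite indicE memNset ?mulr0// /Q/= subr0.
    by apply/negP; rewrite -leNgt.
have FB n x : `|\sum_j quot j (t_ n) x| <= B * \1_Q x.
  have [xN|xN] := ltP `|x| (N + 3); last first.
    rewrite big1 ?normr0 ?mulr_ge0// => j _.
    by rewrite /quot f_far ?mul0r//; lra.
  rewrite indicE mem_set ?mulr1 /Q/= ?subr0//.
  apply: le_trans (ler_norm_sum _ _ _) _.
  apply: (@le_trans _ _ (\sum_(j < d) M)).
    by apply: ler_sum => j _; have [? ? _ _] := t_small n; exact: quot_bound.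
  by rewrite sumr_const card_ord /B mulr_natl.
have mflux : measurable_fun setT (flux : _ -> measurableTypeR R).
  by apply: (measurable_fun_cvg msum_quot) => x _; exact: quot_cvg.
have qc x : (fun n => (\sum_j quot j (t_ n) x)%:E) @ \oo --> (flux x)%:E.
  by apply: cvg_EFin; [exact: nearW|exact: quot_cvg].
have [_ _ cv] := @dominated_convergence _ _ _ (lebesgue_rV R d) setT measurableT
  (fun n x => (\sum_j quot j (t_ n) x)%:E) (EFin \o flux)
  (EFin \o (fun x => B * \1_Q x))
  (fun n => (measurable_EFinP _ _).2 (msum_quot n)) ((measurable_EFinP _ _).2 mflux)
  (aeW _ (fun x _ => qc x))
  intB (aeW _ (fun x n _ => FB n x)).
apply: (cvge_to_le cv); apply: nearW => n /=.
have [t0 t1 LWt Wt] := t_small n.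
have iq j : (lebesgue_rV R d).-integrable setT (EFin \o quot j (t_ n)).
  apply: (@integrable_bounded_support R d _ (N + 3) M) => //.
  - by move=> x; exact: quot_bound.
  - by move=> x xN; rewrite /quot f_far ?mul0r//; lra.
have id' j : (lebesgue_rV R d).-integrable setT
    (EFin \o (fun x => f x * (G j x - G j (x - t_ n *: e j)))).
  rewrite [X in integrable _ _ X](_ : _ = (fun x =>
      ((f x * G j x)%:E - (f x * G j (x - t_ n *: e j))%:E)%E)); last first.
    by apply/funext => x; rewrite /= mulrBr EFinB.
  exact: (integrableB measurableT (int_fG j) (int_fGm j t0 t1)).
under eq_integral do rewrite -sumEFin.
rewrite integral_sum//.
rewrite (_ : d%:R * _ = \sum_(j < d) (L * CG) * (1 + Cp) * m); last first.
  by rewrite sumr_const card_ord mulr_natl.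
rewrite -sumEFin; apply: lee_sum => j _.
rewrite [leLHS](_ : _ = (\int[lebesgue_rV R d]_x
    ((t_ n)^-1%:E * (f x * (G j x - G j (x - t_ n *: e j)))%:E))%E); last first.
  by apply: eq_integral => x _; rewrite /quot mulrA mulrC EFinM.
rewrite integralZl//; last exact: id'.
rewrite (_ : L * CG * (1 + Cp) * m =
  (t_ n)^-1 * (t_ n * (L * CG) * (1 + Cp) * m)); last first.
  by field; rewrite gt_eqF.
rewrite EFinM; apply: lee_wpmul2l; first by rewrite lee_fin invr_ge0 ltW.
exact: step_integral.
Qed.

(** The cutoff is 1 on [A] away from the layer, so there the integral of the
    divergence dominates [c * mu A]; what is missing is at most [c] times the
    measure of the layer. *)
Lemma vector_field_isoperimetry :
  (c%:E * mu A <= (c + d%:R * (K * Cw ^+ 2 * CG * (1 + Cp)))%:E *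
    mu (A `&` [set x | (cutoff w A K x < 1)%R]))%E.
Proof.
have fl0 x : 0 <= flux x.
  rewrite /flux; have [Ax|Ax] := pselect (A x); last by rewrite fout// mul0r.
  by rewrite mulr_ge0//; apply: le_trans (divG Ax); rewrite mulr_ge0// ltW.
have mfl : measurable_fun setT (fun x => (flux x)%:E).
  apply/measurable_EFinP.
  by apply: (measurable_fun_cvg msum_quot) => x _; exact: quot_cvg.
apply: (@le_trans _ _ (\int[lebesgue_rV R d]_x
    ((flux x)%:E + c%:E * (pl x)%:E))%E).
  rewrite /mu -ge0_integralZl_EFin ?(ltW c0)//; last 2 first.
  - by move=> x _; rewrite lee_fin ltW.
  - by apply/measurable_EFinP; exact: measurable_funS mp.
  have fl1 x : 0 <= flux x + c * pl x by rewrite addr_ge0// mulr_ge0// ltW.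
  apply: ge0_integral_mono => x.
  - by move=> _; rewrite -EFinM lee_fin mulr_ge0// ltW.
  - by move=> _; rewrite -EFinM -EFinD lee_fin.
  - move=> Ax; split => //; rewrite -!EFinM -EFinD lee_fin.
    have [xl|xl] := pselect (layer x).
      by rewrite /pl mem_set//= lerDr.
    rewrite /pl memNset// mulr0 addr0 /flux.
    rewrite (_ : f x = 1) ?mul1r ?divG//.
    apply/eqP; rewrite eq_le f1/= leNgt; apply/negP => fx.
    exact: xl.
rewrite ge0_integralD//; last 3 first.
- by move=> x _; rewrite lee_fin.
- by move=> x _; rewrite -EFinM lee_fin mulr_ge0// ltW.
- exact: measurable_funeM.
rewrite ge0_integralZl_EFin ?(ltW c0)//; last by move=> x _; rewrite lee_fin.
rewrite int_pl -/layer.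
apply: le_trans (leeD flux_integral_le (lexx _)) _.
rewrite mE -!EFinM -EFinD lee_fin /L.
by rewrite le_eqVlt; apply/orP; left; apply/eqP; ring.
Qed.

End vector_field.

(** * Consequences of admissibility *)

Section gradient.
Context (R : realType) (d : nat).
Implicit Types (phi : 'rV[R]_d -> R) (x y v : 'rV[R]_d).

Lemma derive_grad phi x v : differentiable phi x ->
  'D_v phi x = \sum_i v ord0 i * grad phi x ord0 i.
Proof.
move=> dphi; rewrite deriveE// {1}(matrix_sum_delta v) big_ord1 linear_sum.
by apply: eq_bigr => i _; rewrite linearZ/= mxE deriveE.
Qed.

Lemma is_derive_grad phi x v : differentiable phi x ->
  is_derive x v phi (\sum_i v ord0 i * grad phi x ord0 i).
Proof.
by move=> dphi; apply: DeriveDef; [exact: diff_derivable|exact: derive_grad].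
Qed.

Lemma gradient_bound phi x y W : (forall z, differentiable phi z) ->
  (forall t, 0 <= t <= 1 -> enorm (grad phi (segment x y t)) <= W) ->
  `|phi y - phi x| <= W * d%:R * `|y - x|.
Proof.
move=> dphi gW; pose v := y - x.
have [s s01] := @line_mean_value _ _ phi
  (fun z => \sum_i v ord0 i * grad phi z ord0 i) x v 1 ler01
  (fun s _ => is_derive_grad v (dphi _)).
rewrite scale1r /v subrKC mulr1 => ->.
apply: le_trans (ler_norm_sum _ _ _) _.
apply: (@le_trans _ _ (\sum_(i < d) W * `|y - x|)); last first.
  rewrite sumr_const card_ord -[leLHS]mulr_natl.
  by rewrite (_ : _%:R * _ = W * d%:R * `|y - x|)//; ring.
apply: ler_sum => i _; rewrite normrM mulrC ler_pM//; last exact: coord_le_norm.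
by apply: le_trans (entry_le_enorm _ _ _) _; exact: gW.
Qed.

Lemma radial_derivativeE phi x : enorm x * radial_derivative phi x =
  \sum_i x ord0 i * grad phi x ord0 i.
Proof.
rewrite /radial_derivative /dotrV; have [x0|x0] := eqVneq (enorm x) 0.
  rewrite x0 mul0r big1// => i _.
  have := entry_le_enorm x ord0 i; rewrite x0 normr_le0 => /eqP ->.
  by rewrite mul0r.
by rewrite mulr_sumr; apply: eq_bigr => i _; rewrite mxE !mulrA divff// mul1r.
Qed.

End gradient.

Section admissible_consequences.
Context (R : realType) (d : nat) (phi : 'rV[R]_d -> R).
Hypothesis d0 : (0 < d)%N.
Hypothesis hphi : admissible phi.
Implicit Types (x y : 'rV[R]_d).

Definition weight x : R := 1 + enorm (grad phi x).

Lemma weight_ge1 x : 1 <= weight x.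
Proof. by rewrite lerDl enorm_ge0. Qed.

Let w0 x : 0 < weight x. Proof. exact: lt_le_trans (weight_ge1 x). Qed.

Let dphi x : differentiable phi x. Proof. by have [[]] := hphi. Qed.

Lemma weight_tame r : 0 <= r -> exists2 C, 1 <= C &
  forall x y, `|x - y| <= r -> weight x <= C * weight y.
Proof.
move=> r0; have [_ _] := admissible_tame hphi.
have rd0 : 0 < d%:R * r + 1 by rewrite ltr_wpDl// mulr_ge0.
move=> /(_ _ rd0)[C C1 HC]; exists C => // x y xy.
have /HC/andP[_] : enorm (x - y) < d%:R * r + 1.
  apply: le_lt_trans (enorm_le_norm _) _.
  by apply: (@le_lt_trans _ _ (d%:R * r)); [rewrite ler_wpM2l|rewrite ltrDl].
by rewrite ler_pdivrMr//; exact: w0.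
Qed.

Lemma weight_bounded N : exists W, forall x, `|x| <= N -> weight x <= W.
Proof.
have [C C1 HC] := weight_tame (normr_ge0 N).
exists (C * weight 0) => x xN; apply: HC.
by rewrite subr0 (le_trans xN)// ler_norm.
Qed.

Lemma segment_dist x y (t : R) : 0 <= t <= 1 -> `|segment x y t - x| <= `|y - x|.
Proof.
move=> /andP[t0 t1]; rewrite /segment addrAC subrr add0r normrZ ger0_norm//.
by rewrite ler_piMl.
Qed.

(** The gradient is at most the weight, which tameness makes comparable to its
    value at [x] along the segment from [x] to [y]. *)
Lemma potential_harnack b : 0 <= b -> exists2 B, 0 <= B &
  forall x y, weight x * `|x - y| <= b -> `|phi y - phi x| <= B.
Proof.
move=> b0; have [C C1 HC] := weight_tame b0.
have C0 : 0 <= C by apply: le_trans C1.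
exists (C * d%:R * b) => [|x y wxy]; first by rewrite !mulr_ge0.
have xyb : `|x - y| <= b.
  by apply: le_trans wxy; rewrite ler_peMl// weight_ge1.
apply: le_trans (@gradient_bound _ _ phi x y (C * weight x) dphi _) _.
  move=> t t01; apply: (@le_trans _ _ (weight (segment x y t))).
    by rewrite /weight lerDr.
  by apply: HC; apply: le_trans (segment_dist x y t01) _; rewrite distrC.
rewrite (_ : _ * _ = C * d%:R * (weight x * `|x - y|)); last first.
  by rewrite distrC; ring.
by rewrite ler_wpM2l// mulr_ge0.
Qed.

Lemma potential_bounded N : exists B, forall x, `|x| <= N -> `|phi x| <= B.
Proof.
have [W HW] := weight_bounded N.
exists (`|phi 0| + W * d%:R * N) => x xN.
rewrite -(subrK (phi 0) (phi x)) addrC; apply: le_trans (ler_normD _ _) _.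
rewrite lerD2l; apply: le_trans (@gradient_bound _ _ phi 0 x W dphi _) _.
  move=> t t01; apply: (@le_trans _ _ (weight (segment 0 x t))).
    by rewrite /weight lerDr.
  apply: HW; apply: le_trans xN.
  by have := segment_dist 0 x t01; rewrite !subr0.
have W0 : 0 <= W.
  by apply: le_trans (ltW (w0 0)) (HW 0 _); rewrite normr0; exact: le_trans xN.
by rewrite subr0 ler_wpM2l// mulr_ge0.
Qed.

(** The limits at infinity, made uniform outside one ball; a small [delta] will
    let the Hessian terms be absorbed. *)
Lemma asymptotics delta : 0 < delta -> exists c T, [/\ 0 < c, 1 <= T &
  forall x, T <= enorm x -> [/\ differentiable (grad phi) x,
    2 <= enorm (grad phi x),
    enorm (hess phi x) <= delta * enorm (grad phi x) ^+ 2 &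
    c * enorm (grad phi x) <= radial_derivative phi x]].
Proof.
move=> delta0.
have [tau0 tau00 [C2 _]] := admissible_C2 hphi.
have /cvgryPge/(_ 2)[T1 HT1] := admissible_grad hphi.
have /cvgrPdist_le/(_ delta delta0)[T2 HT2] := admissible_hess hphi.
have [c c0 [T3 HT3]] : exists2 c, 0 < c & (\forall x \near @at_infty R d,
    c <= radial_derivative phi x / enorm (grad phi x)).
  have := admissible_radial hphi; rewrite limf_einfE.
  move=> /ereal_sup_gt[_ [P FP <-]] /=.
  set I := ereal_inf _ => I0.
  have HI x : P x -> (I <= (radial_derivative phi x / enorm (grad phi x))%:E)%E.
    by move=> Px; apply: ereal_inf_lbound; exists x.
  case: I I0 HI => [r| |]//.
    rewrite lte_fin => r0 HI; exists r => //.
    by apply: filterS FP => x /HI; rewrite lee_fin.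
  move=> _ HI; exists 1 => //; apply: filterS FP => x /HI.
  by rewrite leye_eq.
pose T := `|tau0| + `|T1| + `|T2| + `|T3| + 1.
have := (ler_norm tau0, ler_norm T1, ler_norm T2, ler_norm T3).
have := (normr_ge0 tau0, normr_ge0 T1, normr_ge0 T2, normr_ge0 T3).
move=> [[[? ?] ?] ?] [[[? ?] ?] ?].
exists c, T; split => //; first by rewrite lerDr !addr_ge0.
move=> x Tx.
have g2 : 2 <= enorm (grad phi x) by apply: HT1; rewrite /T in Tx; lra.
have g0 : 0 < enorm (grad phi x) by exact: lt_le_trans g2.
split => //.
- by apply: C2 => /=; rewrite /T in Tx; lra.
- have := HT2 x; rewrite sub0r normrN ger0_norm; last first.
    by rewrite divr_ge0 ?enorm_ge0// sqr_ge0.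
  rewrite ler_pdivrMr ?exprn_gt0//; apply.
  by rewrite /T in Tx; lra.
- have := HT3 x; rewrite ler_pdivlMr//; apply.
  by rewrite /T in Tx; lra.
Qed.

(** Outside a ball the radial derivative is bounded below by a positive
    constant, which is integrated along rays. *)
Lemma potential_growth : exists c C, 0 < c /\ forall x, c * `|x| - C <= phi x.
Proof.
have [c [T [c0 T1 HT]]] := asymptotics ltr01.
have [B HB] := potential_bounded (T + 1).
have near_bound x : enorm x <= T + 1 -> `|phi x| <= B.
  by move=> xT; apply: HB; apply: le_trans (norm_le_enorm x) xT.
have B0 : 0 <= B by apply: le_trans (near_bound 0 _); rewrite // /enorm;
  rewrite big1 ?sqrtr0; [lra|move=> i _; rewrite big1// => j _; rewrite mxE expr0n].
exists c, (B + c * (T + 1)); split => // x.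
have cx : c * `|x| <= c * enorm x by rewrite ler_pM2l// norm_le_enorm.
have [xT|xT] := leP (enorm x) (T + 1).
  have := near_bound x xT; rewrite ler_norml => /andP[? _].
  have : c * enorm x <= c * (T + 1) by rewrite ler_pM2l.
  by lra.
have ex0 : 0 < enorm x by lra.
pose s0 := (T + 1) / enorm x.
have s00 : 0 < s0 by rewrite divr_gt0//; lra.
have s01 : s0 < 1 by rewrite /s0 ltr_pdivrMr// mul1r.
have [|s /andP[s_ge0 ss0]] := @line_mean_value _ _ phi
  (fun z => \sum_i x ord0 i * grad phi z ord0 i) (s0 *: x) x (1 - s0) _
  (fun s _ => is_derive_grad x (dphi _)); first by rewrite subr_ge0 ltW.
rewrite -!scalerDl subrKC scale1r; set z := (s0 + s) *: x => E.
have zx : enorm z = (s0 + s) * enorm x.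
  by rewrite /z enormZ ger0_norm// addr_ge0// ltW.
have zT : T <= enorm z.
  rewrite zx mulrDl /s0 divfK ?gt_eqF//.
  have := mulr_ge0 s_ge0 (ltW ex0); lra.
have [_ g2 _ cg] := HT z zT.
have crad : c <= radial_derivative phi z.
  by apply: le_trans cg; rewrite ler_peMr ?(ltW c0)//; lra.
have Ez : \sum_i x ord0 i * grad phi z ord0 i = enorm x * radial_derivative phi z.
  (* the radial direction at [z] is that of [x], since [z] is a multiple of it *)
  have ss : 0 < s0 + s by rewrite ltr_wpDr.
  apply: (mulfI (lt0r_neq0 ss)); rewrite mulrA -zx radial_derivativeE mulr_sumr.
  by apply: eq_bigr => i _; rewrite [z ord0 i]mxE mulrA.
move: E; rewrite Ez => E.
have : - B <= phi (s0 *: x).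
  have : `|phi (s0 *: x)| <= B.
    apply: near_bound; rewrite enormZ ger0_norm ?(ltW s00)//.
    by rewrite /s0 divfK// gt_eqF.
  by rewrite ler_norml => /andP[].
have : c * enorm x * (1 - s0) <= enorm x * radial_derivative phi z * (1 - s0).
  by rewrite ler_pM2r ?subr_gt0// mulrC ler_pM2l.
have : c * enorm x * (1 - s0) = c * enorm x - c * (T + 1).
  by rewrite mulrBr mulr1 /s0; congr (_ - _); field; rewrite gt_eqF.
by move=> e1; rewrite e1 -E; lra.
Qed.

(** * The metric and the doubling property *)

(** The length of the Euclidean segment; the weight may be frozen at either
    end. *)
Lemma rho_le b : 0 <= b -> exists2 C, 1 <= C & forall x y, `|y - x| <= b ->
  rho_ phi x y <= C * weight x * `|y - x| /\ rho_ phi x y <= C * weight y * `|y - x|.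
Proof.
move=> b0; have [C C1 HC] := weight_tame b0.
have d1 : 1 <= d%:R :> R by rewrite ler1n.
have C0 : 0 <= C by apply: le_trans C1.
exists (C * d%:R) => [|x y yx]; first by rewrite -[leLHS]mul1r ler_pM.
have H W : (forall t, 0 <= t <= 1 -> weight (segment x y t) <= C * W) -> 0 <= W ->
    rho_ phi x y <= C * d%:R * W * `|y - x|.
  move=> HW W0.
  apply: le_trans (conformal_dist_le_segment (W := C * W) _ HW) _.
    by move=> z; exact: ltW (w0 z).
  rewrite (_ : _ * `|y - x| = C * W * (d%:R * `|y - x|)); last by ring.
  by rewrite ler_wpM2l ?enorm_le_norm// mulr_ge0.
split; (apply: H; last exact: ltW) => t t01.
  by apply: HC; apply: le_trans (segment_dist x y t01) yx.
apply: HC; rewrite (_ : _ - y = - ((1 - t) *: (y - x))); last first.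
  by rewrite /segment scalerBl scale1r !opprB addrA [x + _]addrC.
rewrite normrN normrZ; apply: le_trans yx.
rewrite ler_piMl// ger0_norm; first by lra.
by move/andP: t01; lra.
Qed.

Lemma rho_ball_subset b : 0 <= b -> exists2 C, 1 <= C & forall x y r, 0 <= r ->
  r <= b -> rho_ phi x y < r -> `|y - x| <= r /\ weight x * `|y - x| <= C * r.
Proof.
move=> b0; have [C C1 HC] := weight_tame b0.
have C0 : 0 < C by apply: lt_le_trans C1.
exists C => // x y r r0 rb rxy.
have [W HW] := weight_bounded (`|x| + `|y - x|).
have [|||yx myx] := @norm_le_conformal_dist _ _ weight x y b r (weight x / C) W
    weight_ge1 _ _ _ r0 rb rxy.
- by rewrite divr_ge0 ?ltW.
- move=> t t01; apply: HW; rewrite -[segment x y t](subrK x) addrC.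
  by apply: le_trans (ler_normD _ _) _; rewrite lerD2l segment_dist.
- by move=> z zx; rewrite ler_pdivrMr// mulrC HC// distrC.
split => //; move: myx.
by rewrite mulrAC ler_pdivrMr// [r * C]mulrC.
Qed.

Lemma mu_mono (psi : 'rV[R]_d -> R) A B : A `<=` B -> (mu_ psi A <= mu_ psi B)%E.
Proof.
move=> AB; apply: ge0_integral_mono => x.
- by move=> _; rewrite lee_fin expR_ge0.
- by move=> _; rewrite lee_fin expR_ge0.
- by move=> /AB.
Qed.

Lemma mu_cube_le (psi : 'rV[R]_d -> R) x r M : 0 < r ->
  (forall y, `|y - x| < r -> psi y <= M) ->
  (mu_ psi [set y | (`|y - x| < r)%R] <= (expR M * (2 * r) ^+ d)%:E)%E.
Proof.
move=> r0 psiM; pose Q : set 'rV[R]_d := [set y | `|y - x| < r].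
apply: (@le_trans _ _ (\int[lebesgue_rV R d]_(y in Q) (cst (expR M)%:E) y)%E).
  apply: ge0_integral_mono => y.
  - by move=> _; rewrite lee_fin expR_ge0.
  - by move=> _; rewrite lee_fin expR_ge0.
  - by move=> yx; split => //; rewrite lee_fin ler_expR psiM.
by rewrite integral_cst; [rewrite [X in (_ * X)%E]lebesgue_rV_cube// EFinM|exact: measurable_cube].
Qed.

Lemma mu_cube_ge (psi : 'rV[R]_d -> R) x r M : 0 < r ->
  (forall y, `|y - x| < r -> M <= psi y) ->
  ((expR M * (2 * r) ^+ d)%:E <= mu_ psi [set y | (`|y - x| < r)%R])%E.
Proof.
move=> r0 psiM; pose Q : set 'rV[R]_d := [set y | `|y - x| < r].
apply: (@le_trans _ _ (\int[lebesgue_rV R d]_(y in Q) (cst (expR M)%:E) y)%E).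
  by rewrite integral_cst; [rewrite [X in (_ * X)%E]lebesgue_rV_cube// EFinM|exact: measurable_cube].
apply: ge0_integral_mono => y.
- by move=> _; rewrite lee_fin expR_ge0.
- by move=> _; rewrite lee_fin expR_ge0.
- by move=> yx; split => //; rewrite lee_fin ler_expR psiM.
Qed.

(** A metric ball of bounded radius lies between two cubes of comparable sizes,
    on which the density is comparable with its value at the centre. *)
Lemma doubling (psi : 'rV[R]_d -> R) :
  (forall b, 0 <= b -> exists2 B, 0 <= B &
    forall x y, weight x * `|x - y| <= b -> `|psi y - psi x| <= B) ->
  locally_doubling (rho_ phi) (mu_ psi).
Proof.
move=> psiH b b0.
have b20 : 0 <= 2 * b by lra.
have [C C1 HC] := rho_ball_subset b20.
have [C' C'1 HC'] := rho_le b20.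
have C0 : 0 < C by exact: lt_le_trans C1.
have C'0 : 0 < C' by exact: lt_le_trans C'1.
have [|B B0 HB] := psiH (2 * C * (2 * b) + 2 * b).
  by rewrite addr_ge0// !mulr_ge0// ltW.
exists (expR (B + B) * (4 * C * C') ^+ d) => x r r0 rb.
pose s1 := 4 * C * r / weight x.
pose s2 := r / (C' * weight x).
have s10 : 0 < s1 by rewrite divr_gt0// !mulr_gt0.
have s20 : 0 < s2 by rewrite divr_gt0// mulr_gt0.
have ws1 y : `|y - x| < s1 -> `|psi y - psi x| <= B.
  rewrite /s1 ltr_pdivlMr// => yx; apply: HB; rewrite distrC mulrC.
  apply: le_trans (ltW yx) _.
  have : C * r <= C * b by rewrite ler_pM2l.
  by lra.
have ws2 y : `|y - x| < s2 -> `|psi y - psi x| <= B.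
  rewrite /s2 ltr_pdivlMr ?mulr_gt0// => yx; apply: HB; rewrite distrC mulrC.
  have h1 : `|y - x| * weight x <= `|y - x| * (C' * weight x).
    by rewrite ler_wpM2l// ler_peMl// ltW.
  have h2 : 0 <= C * b by rewrite mulr_ge0 ?ltW.
  by lra.
have le2 : (mu_ psi (mball (rho_ phi) x (2 * r)) <=
    (expR (psi x + B) * (2 * s1) ^+ d)%:E)%E.
  apply: le_trans (mu_cube_le s10 _).
    apply: mu_mono => y xy.
    have [||_] := HC x y (2 * r) _ _ xy; [lra|lra|move=> h].
    rewrite /= /s1 ltr_pdivlMr// mulrC; apply: le_lt_trans h _.
    by have := mulr_gt0 C0 r0; lra.
  by move=> y /ws1; rewrite ler_norml => /andP[? ?]; lra.
have ge1 : ((expR (psi x - B) * (2 * s2) ^+ d)%:E <=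
    mu_ psi (mball (rho_ phi) x r))%E.
  apply: le_trans (@mu_cube_ge psi x s2 _ s20 _) _.
    by move=> y /ws2; rewrite ler_norml => /andP[? ?]; lra.
  apply: mu_mono => y /= yx; rewrite /mball/=.
  have yb : `|y - x| <= 2 * b.
    have : s2 <= r.
      rewrite /s2 ler_pdivrMr ?mulr_gt0// ler_peMr ?(ltW r0)//.
      by rewrite -[leLHS]mul1r ler_pM// weight_ge1.
    by lra.
  have [h _] := HC' x y yb; apply: le_lt_trans h _.
  by rewrite mulrC -ltr_pdivlMr// mulr_gt0.
apply: le_trans le2 _.
apply: (@le_trans _ _ ((expR (B + B) * (4 * C * C') ^+ d)%:E *
   (expR (psi x - B) * (2 * s2) ^+ d)%:E)%E); last first.
  by apply: lee_wpmul2l => //; rewrite lee_fin mulr_ge0 ?expR_ge0// exprn_ge0// !mulr_ge0 ?ltW.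
rewrite -EFinM lee_fin mulrACA -expRD -exprMn.
rewrite (_ : B + B + _ = psi x + B); last by ring.
rewrite (_ : 4 * C * C' * _ = 2 * s1)//.
by rewrite /s1 /s2; field; rewrite !gt_eqF.
Qed.

Lemma mu_infinite : mu_ phi [set: 'rV[R]_d] = +oo%E.
Proof.
have [c [C [c0 HC]]] := potential_growth.
apply/eqP; rewrite -leye_eq.
apply: (@le_trans _ _ (\int[lebesgue_rV R d]_(y in setT) (cst (expR (- C))%:E) y)%E).
  have LT : lebesgue_rV R d setT = +oo%E.
    transitivity (lebesgue_rV R d
        [set v | forall i : 'I_d, (fun=> setT) i (v ord0 i : measurableTypeR R)]).
      by congr (lebesgue_rV R d _); apply/seteqP; split.
    rewrite (@lebesgue_rV_box R d (fun=> setT))//.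
    have lmT : lebesgue_measure [set: measurableTypeR R] = +oo%E.
      by rewrite -set_itvNyy lebesgue_measure_itv.
    case: d d0 => // n _; elim: n => [|n IH].
      by rewrite big_ord1 lmT.
    by rewrite big_ord_recl IH lmT.
  by rewrite integral_cst// [X in (_ * X)%E]LT gt0_muley// lte_fin expR_gt0.
apply: ge0_integral_mono => y _.
- by rewrite lee_fin expR_ge0.
- by rewrite lee_fin expR_ge0.
- split => //; rewrite lee_fin ler_expR.
  by apply: le_trans (HC y); rewrite lerDr mulr_ge0 ?(ltW c0).
Qed.

End admissible_consequences.

(** * The vector fields *)

Section directional_chain_rule.
Context (R : realType) (V : normedModType R).

Lemma is_derive_of_line (f : V -> R) x v df :
  is_derive (0 : R) (1 : R) (fun s : R => f (x + s *: v)) df -> is_derive x v f df.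
Proof.
have E : (fun h : R => h^-1 *: (((fun s : R => f (x + s *: v)) \o shift 0) (h *: (1 : R)) -
    f (x + 0 *: v))) =
  (fun h : R => h^-1 *: ((f \o shift x) (h *: v) - f x)).
  apply/funext => h /=; rewrite scale0r !addr0 [h *: 1]mulr1.
  by rewrite [x + _]addrC.
by case; rewrite /derivable /derive E => ? ?; apply: DeriveDef.
Qed.

Lemma is_derive_chain (f : R -> R) (u : V -> R) x v a b :
  is_derive (u x) (1 : R) f a -> is_derive x v u b ->
  is_derive x v (fun y => f (u y)) (a * b).
Proof.
move=> fa ub; apply: is_derive_of_line.
have ul : is_derive (0 : R) (1 : R) (fun s : R => u (x + s *: v)) b.
  by apply: is_derive_line; rewrite scale0r addr0.
have fl : is_derive ((fun s : R => u (x + s *: v)) 0) (1 : R) f a.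
  by rewrite /= scale0r addr0.
exact: (is_derive1_comp fl ul).
Qed.

Lemma is_derive_mul (f g : V -> R) x v a b :
  is_derive x v f a -> is_derive x v g b ->
  is_derive x v (fun y => f y * g y) (f x * b + g x * a).
Proof. by move=> fa gb; have := is_deriveM fa gb. Qed.

Lemma is_derive_add (f g : V -> R) x v a b :
  is_derive x v f a -> is_derive x v g b ->
  is_derive x v (fun y => f y + g y) (a + b).
Proof. by move=> fa gb; have := is_deriveD fa gb. Qed.

Lemma is_derive_bigsum n (f : 'I_n -> V -> R) x v (a : 'I_n -> R) :
  (forall i, is_derive x v (f i) (a i)) ->
  is_derive x v (fun y => \sum_i f i y) (\sum_i a i).
Proof.
move=> fa; have := is_derive_sum fa.
by rewrite (_ : \sum_i f i = fun y => \sum_i f i y)//; apply/funext => y; rewrite fct_sumE.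
Qed.

Lemma is_derive_scalar (f : V -> R) x v a c :
  is_derive x v f a -> is_derive x v (fun y => c * f y) (c * a).
Proof. by move=> fa; have := is_deriveZ c fa. Qed.

Lemma is_derive_inv (f : V -> R) x v a : f x != 0 ->
  is_derive x v f a -> is_derive x v (fun y => (f y)^-1) (- f x ^- 2 * a).
Proof.
move=> fx0 [df fE]; apply: DeriveDef; first exact: derivableV.
by rewrite deriveV// fE.
Qed.

End directional_chain_rule.

Section squared_positive_part.
Context (R : realType).
Implicit Types u : R.

Definition posp u : R := Num.max u 0.
Definition pos2 u : R := posp u ^+ 2.

Lemma posp_ge0 u : 0 <= posp u. Proof. by rewrite /posp le_max lexx orbT. Qed.
Lemma pospE u : 0 <= u -> posp u = u. Proof. by move=> u0; rewrite /posp max_l. Qed.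
Lemma posp0 u : u <= 0 -> posp u = 0. Proof. by move=> u0; rewrite /posp max_r. Qed.
Lemma pos2_ge0 u : 0 <= pos2 u. Proof. exact: sqr_ge0. Qed.
Lemma pos2_0 u : u <= 0 -> pos2 u = 0. Proof. by move=> /posp0; rewrite /pos2 => ->; rewrite expr0n. Qed.
Lemma posp_le u a : 0 <= a -> u <= a -> posp u <= a.
Proof. by move=> a0 ua; rewrite /posp ge_max ua. Qed.

Lemma posp_continuous : continuous posp.
Proof. by move=> u; apply: continuous_max; [exact: cvg_id|exact: cvg_cst]. Qed.

Lemma is_derive_pos2 u : is_derive u (1 : R) pos2 (2 * posp u).
Proof.
have [u0|u0|->] := ltgtP u 0.
- rewrite posp0 ?ltW// mulr0.
  apply: (@near_eq_is_derive _ _ _ (cst 0)).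
  near=> s; rewrite pos2_0//; apply: ltW; near: s; exact: lt_nbhsl.
- rewrite pospE ?ltW//.
  have H : is_derive u (1 : R) (fun s : R => s ^+ 2) (2 * u).
    have D := is_derive_mul (is_derive_id u (1 : R)) (is_derive_id u (1 : R)).
    by apply: (is_derive_eq D) => /=; ring.
  apply: near_eq_is_derive H.
  near=> s; rewrite /pos2 pospE//; apply: ltW; near: s; exact: lt_nbhsr.
- have H : (fun h : R => h^-1 *: ((pos2 \o shift 0) (h *: (1 : R)) - pos2 0)) @ 0^' --> (0 : R).
    apply/cvgrPdist_le => e e0; near=> h.
    rewrite /= addr0 [h *: 1]mulr1 (@pos2_0 0)// subr0 sub0r normrN.
    have h0 : h != 0 by near: h; exact: nbhs_dnbhs_neq.
    have he : `|h| <= e by near: h; exact: dnbhs0_le.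
    apply: le_trans he; rewrite normrZ normfV ler_pdivrMl ?normr_gt0// -expr2.
    rewrite ger0_norm ?pos2_ge0// /pos2 lerXn2r ?nnegrE ?posp_ge0//.
    exact: posp_le (ler_norm h).
  rewrite posp0// mulr0; apply: DeriveDef; first by apply/cvg_ex; exists 0.
  exact: cvg_lim.
Unshelve. all: by end_near. Qed.

End squared_positive_part.

Lemma continuous_after (T U V : topologicalType) (f : T -> U) (g : U -> V) :
  continuous f -> continuous g -> continuous (fun x => g (f x)).
Proof. by move=> cf cg x; exact: (continuous_comp (cf x) (cg (f x))). Qed.

Lemma continuous_sub (R : realType) (T : topologicalType) (f g : T -> R) :
  continuous f -> continuous g -> continuous (fun x => f x - g x).
Proof. by move=> cf cg x; exact: (continuousB (cf x) (cg x)). Qed.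

Lemma continuous_add (R : realType) (T : topologicalType) (f g : T -> R) :
  continuous f -> continuous g -> continuous (fun x => f x + g x).
Proof. by move=> cf cg x; exact: (continuousD (cf x) (cg x)). Qed.

Lemma continuous_mul (R : realType) (T : topologicalType) (f g : T -> R) :
  continuous f -> continuous g -> continuous (fun x => f x * g x).
Proof. by move=> cf cg x; exact: (continuousM (cf x) (cg x)). Qed.

Lemma continuous_const (R : realType) (T : topologicalType) (a : R) :
  continuous (fun _ : T => a).
Proof. by move=> x; exact: cvg_cst. Qed.

Lemma continuous_inv (R : realType) (T : topologicalType) (f : T -> R) :
  (forall x, f x != 0) -> continuous f -> continuous (fun x => (f x)^-1).
Proof. by move=> f0 cf x; apply: cvgV; [exact: f0|exact: cf]. Qed.

Section outer_field.
Context (R : realType) (d : nat) (phi : 'rV[R]_d -> R).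
Hypothesis hphi : admissible phi.
Variables (c T tau sigma : R).
Implicit Types (x y : 'rV[R]_d).

(** The square is used because, unlike [enorm], it is differentiable at the
    origin. *)
Definition sqn x : R := \sum_k x ord0 k ^+ 2.

Lemma sqnE x : sqn x = enorm x ^+ 2. Proof. by rewrite sqr_enorm_rV. Qed.

Lemma sqn_ge0 x : 0 <= sqn x. Proof. by rewrite sqnE sqr_ge0. Qed.

Let e (j : 'I_d) : 'rV[R]_d := delta_mx ord0 j.

Lemma is_derive_coordinate x k v : is_derive x v (fun y : 'rV[R]_d => y ord0 k) (v ord0 k).
Proof.
have H : is_derive x v (fun y : 'rV[R]_d => y) v by exact: is_derive_id.
have [D E] := H.
apply: DeriveDef; first by have /derivable_mxP := D; apply.
by rewrite -[RHS](congr1 (fun u : 'rV[R]_d => u ord0 k) E) derive_mx// mxE.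
Qed.

Lemma is_derive_sqn x v : is_derive x v sqn (\sum_k 2 * x ord0 k * v ord0 k).
Proof.
apply: is_derive_bigsum => k.
have D := is_derive_mul (is_derive_coordinate x k v) (is_derive_coordinate x k v).
by apply: (is_derive_eq D); ring.
Qed.

Lemma is_derive_sqn_e x j : is_derive x (e j) sqn (2 * x ord0 j).
Proof.
have := is_derive_sqn x (e j).
rewrite (bigD1 j)//= big1 ?addr0 => [|k kj].
  by rewrite mxE !eqxx mulr1.
by rewrite mxE (negbTE kj) andbF mulr0.
Qed.

Let g x := grad phi x.
Let S x := sqn (g x).

(** The field [grad phi / |grad phi|^2] wherever the gradient has norm at least
    1; the truncation of the denominator keeps it continuous elsewhere. *)
Definition field_dir j x : R := g x ord0 j / Num.max (S x) 1.

(** A C^1 cutoff: 0 on the ball of radius [tau], 1 outside the ball of radius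
    [Num.sqrt (tau ^+ 2 + 1)], increasing in between. *)
Definition eta x : R := 1 - pos2 (1 - pos2 (sqn x - tau ^+ 2)).

(** The derivative of [eta] with respect to [sqn]. *)
Definition deta x : R :=
  4 * (posp (1 - pos2 (sqn x - tau ^+ 2)) * posp (sqn x - tau ^+ 2)).

(** The field [sigma * grad phi / |grad phi|^2], cut off near the origin and
    multiplied by the density. *)
Definition outer_field j x : R :=
  sigma * (expR (sigma * phi x) * (eta x * field_dir j x)).

Definition dfield_dir j x : R :=
  (hess phi x j j * S x - g x ord0 j * \sum_k 2 * g x ord0 k * hess phi x j k) / S x ^+ 2.

Definition douter_field j x : R :=
  sigma * (expR (sigma * phi x) * (sigma * g x ord0 j * (eta x * field_dir j x) +
    (deta x * (2 * x ord0 j) * field_dir j x + eta x * dfield_dir j x))).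

Lemma is_derive_eta x j : is_derive x (e j) eta (deta x * (2 * x ord0 j)).
Proof.
have Ht : is_derive x (e j) (fun y => sqn y - tau ^+ 2) (2 * x ord0 j).
  have := is_derive_add (is_derive_sqn_e x j) (is_derive_cst (- tau ^+ 2 : R) x (e j)).
  by rewrite addr0.
have H1 := is_derive_chain (is_derive_pos2 _) Ht.
have H2 : is_derive x (e j) (fun y => 1 - pos2 (sqn y - tau ^+ 2))
    (- 1 * (2 * posp (sqn x - tau ^+ 2) * (2 * x ord0 j))).
  have := is_derive_add (is_derive_cst (1 : R) x (e j)) (is_derive_scalar (- 1) H1).
  rewrite add0r (_ : (fun _ => _) = (fun y => 1 - pos2 (sqn y - tau ^+ 2)))//.
  by apply/funext => y; rewrite mulN1r.
have H3 := is_derive_chain (is_derive_pos2 _) H2.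
have := is_derive_add (is_derive_cst (1 : R) x (e j)) (is_derive_scalar (- 1) H3).
rewrite (_ : (fun _ => _) = eta); last by apply/funext => y; rewrite mulN1r.
by move=> D; apply: (is_derive_eq D); rewrite /deta; ring.
Qed.

Hypothesis T1 : 1 <= T.
Hypothesis tauT : T < tau.
Hypothesis sigma2 : sigma ^+ 2 = 1.
(* The small constant makes the divergence of the direction field at most 1/2
   in absolute value. *)
Hypothesis HT : forall x, T <= enorm x -> [/\ differentiable (grad phi) x,
    2 <= enorm (grad phi x),
    enorm (hess phi x) <= (2 * d%:R * (1 + 2 * d%:R) + 1)^-1 * enorm (grad phi x) ^+ 2 &
    c * enorm (grad phi x) <= radial_derivative phi x].
Hypothesis c0 : 0 < c.

Let dphi x : differentiable phi x. Proof. by have [[]] := hphi. Qed.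
Let cgrad : continuous (grad phi). Proof. by have [[]] := hphi. Qed.

Lemma sqn_continuous : continuous sqn.
Proof.
apply: continuous_big => [|k _ x]; first exact: add_continuous.
apply: (@continuous_comp _ _ _ (fun y : 'rV[R]_d => y ord0 k) (fun s => s ^+ 2)).
  exact: coord_continuous.
exact: exprn_continuous.
Qed.

Let cS : continuous S.
Proof. exact: (continuous_after cgrad sqn_continuous). Qed.

Lemma field_dir_continuous j : continuous (field_dir j).
Proof.
apply: (continuous_mul (continuous_after cgrad (@coord_continuous R 1 d ord0 j))).
apply: continuous_inv => x; first by rewrite gt_eqF// lt_max ltr01 orbT.
by apply: continuous_max; [exact: cS|exact: continuous_const].
Qed.

Lemma pos2_continuous : continuous (@pos2 R).
Proof. exact: (continuous_mul (@posp_continuous R) (@posp_continuous R)). Qed.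

Lemma eta_continuous : continuous eta.
Proof.
have c1 := continuous_sub sqn_continuous (@continuous_const R _ (tau ^+ 2)).
have c2 := continuous_sub (@continuous_const R _ 1) (continuous_after c1 pos2_continuous).
exact: (continuous_sub (@continuous_const R _ 1) (continuous_after c2 pos2_continuous)).
Qed.

Lemma outer_field_continuous j : continuous (outer_field j).
Proof.
have cphi : continuous phi by move=> x; exact: differentiable_continuous.
have ce := continuous_after (continuous_mul (@continuous_const R _ sigma) cphi)
  (@continuous_expR R).
exact: (continuous_mul (@continuous_const R _ sigma)
  (continuous_mul ce (continuous_mul eta_continuous (@field_dir_continuous j)))).
Qed.

Let S4 x : T <= enorm x -> 4 <= S x.
Proof.
move=> /HT[_ g2 _ _]; rewrite /S sqnE (_ : 4 = 2 ^+ 2 :> R); last by ring.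
by rewrite lerXn2r ?nnegrE ?enorm_ge0.
Qed.

Lemma is_derive_grad_entry x j k : T <= enorm x ->
  is_derive x (e j) (fun y => g y ord0 k) (hess phi x j k).
Proof.
move=> /HT[dg _ _ _]; apply: DeriveDef; last by rewrite mxE.
have /derivable_mxP := @diff_derivable _ _ _ _ _ (e j) dg; exact.
Qed.

Lemma is_derive_field_dir x j : T <= enorm x ->
  is_derive x (e j) (field_dir j) (dfield_dir j x).
Proof.
move=> Tx; have Sx4 := S4 Tx; have Sx0 : S x != 0 by rewrite gt_eqF//; lra.
have dS : is_derive x (e j) S (\sum_k 2 * g x ord0 k * hess phi x j k).
  apply: is_derive_bigsum => k.
  have D := is_derive_mul (is_derive_grad_entry j k Tx) (is_derive_grad_entry j k Tx).
  by apply: (is_derive_eq D); ring.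
have dV := is_derive_inv Sx0 dS.
have D := is_derive_mul (is_derive_grad_entry j j Tx) dV.
have near_eq : \near x, g x ord0 j * (S x)^-1 = field_dir j x.
  have : \forall y \near x, 1 < S y.
    have S1 : 1 < S x by lra.
    exact: (@cS x _ (lt_nbhsr S1)).
  apply: filterS => y Sy; rewrite /field_dir max_l//; exact: ltW.
apply: (near_eq_is_derive near_eq); apply: (is_derive_eq D).
by rewrite /dfield_dir /GRing.scale/=; field.
Qed.

Lemma eta_in x : enorm x <= tau -> eta x = 0 /\ deta x = 0.
Proof.
move=> xt; have t0 : sqn x - tau ^+ 2 <= 0.
  rewrite sqnE subr_le0 lerXn2r// nnegrE ?enorm_ge0//.
  exact: le_trans (enorm_ge0 _) xt.
by rewrite /eta /deta (pos2_0 t0) subr0 (posp0 t0) !mulr0 /pos2 pospE// expr1n subrr.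
Qed.

Lemma eta_out x : tau ^+ 2 + 1 <= sqn x -> eta x = 1 /\ deta x = 0.
Proof.
move=> xt; have t1 : 1 - pos2 (sqn x - tau ^+ 2) <= 0.
  rewrite subr_le0 /pos2 pospE; last by lra.
  by rewrite -[leLHS](expr1n _ 2) lerXn2r ?nnegrE//; lra.
by rewrite /eta /deta (pos2_0 t1) subr0 (posp0 t1) mul0r mulr0.
Qed.

Lemma eta_ge0 x : 0 <= eta x.
Proof.
rewrite /eta subr_ge0 /pos2 -[leRHS](expr1n _ 2) lerXn2r ?nnegrE ?posp_ge0//.
by apply: posp_le => //; rewrite gerBl pos2_ge0.
Qed.

Lemma eta_le1 x : eta x <= 1. Proof. by rewrite /eta gerBl pos2_ge0. Qed.

Lemma deta_ge0 x : 0 <= deta x.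
Proof. by rewrite /deta !mulr_ge0// posp_ge0. Qed.

Lemma deta_le4 x : deta x <= 4.
Proof.
rewrite /deta -[leRHS]mulr1 ler_wpM2l//; set t := sqn x - _.
have [t1|/ltW t1] := leP 1 (posp t).
  rewrite posp0 ?mul0r// subr_le0 /pos2 -[leLHS](expr1n _ 2) lerXn2r ?nnegrE//.
  exact: posp_ge0.
rewrite -[leRHS]mulr1 ler_pM ?posp_ge0//.
by apply: posp_le => //; rewrite gerBl pos2_ge0.
Qed.

(** The direction field is differentiable outside the ball of radius [T], and
    the product vanishes identically inside the ball of radius [tau > T]. *)
Lemma is_derive_outer_field x j :
  is_derive x (e j) (outer_field j) (douter_field j x).
Proof.
have [Tx|xT] := leP T (enorm x).
  have dE : is_derive x (e j) (fun y => expR (sigma * phi y))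
      (expR (sigma * phi x) * (sigma * g x ord0 j)).
    apply: is_derive_chain; apply: is_derive_scalar.
    apply: DeriveDef; first exact: diff_derivable.
    by rewrite /g mxE.
  have D := is_derive_scalar sigma (is_derive_mul dE
    (is_derive_mul (is_derive_eta x j) (is_derive_field_dir j Tx))).
  by apply: (is_derive_eq D); rewrite /douter_field; ring.
have xt : enorm x < tau by exact: lt_trans tauT.
have -> : douter_field j x = 0.
  by have [e1 e2] := eta_in (ltW xt); rewrite /douter_field e1 e2 !mul0r !mulr0 !addr0 !mulr0.
have c0' : is_derive x (e j) (fun _ : 'rV[R]_d => 0 : R) 0 by exact: is_derive_cst.
apply: near_eq_is_derive c0'.
have : \forall y \near x, sqn y < tau ^+ 2.
  have sx : sqn x < tau ^+ 2.
    by rewrite sqnE ltrXn2r ?nnegrE ?enorm_ge0//; apply: le_trans (ltW xt); exact: enorm_ge0.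
  exact: (@sqn_continuous x _ (lt_nbhsl sx)).
apply: filterS => y yt; have [|e1 _] := @eta_in y.
  have tau0 : 0 <= tau by apply: le_trans (ltW xt); exact: enorm_ge0.
  by rewrite -(@ler_pXn2r _ 2)// ?nnegrE ?enorm_ge0// -sqnE; exact: ltW.
by rewrite /outer_field e1 mul0r !mulr0.
Qed.

(** Differentiating [grad phi / |grad phi|^2] produces terms of size
    [|Hess phi| / |grad phi|^2]. *)
Lemma dfield_dir_bound x j : T <= enorm x ->
  `|dfield_dir j x| <= (2 * d%:R * (1 + 2 * d%:R) + 1)^-1 * (1 + 2 * d%:R).
Proof.
move=> Tx; have Sx4 := S4 Tx; have Sx0 : 0 < S x by lra.
have [_ _ hH _] := HT Tx.
set delta := _^-1 in hH *; set n := enorm (g x).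
have nS : n ^+ 2 = S x by rewrite /S sqnE.
have n0 : 0 <= n by exact: enorm_ge0.
have H0 : 0 <= enorm (hess phi x) by exact: enorm_ge0.
rewrite -/(g x) -/n nS in hH.
rewrite /dfield_dir normrM normfV (ger0_norm (exprn_ge0 2 (ltW Sx0))).
rewrite ler_pdivrMr ?exprn_gt0//.
apply: le_trans (ler_normB _ _) _; rewrite !normrM (ger0_norm (ltW Sx0)).
have h1 : `|hess phi x j j| * S x <= delta * S x ^+ 2.
  rewrite expr2 mulrA ler_pM2r//; apply: le_trans hH; exact: entry_le_enorm.
have h2 : `|\sum_k 2 * g x ord0 k * hess phi x j k| <= d%:R * (2 * (n * (delta * S x))).
  apply: le_trans (ler_norm_sum _ _ _) _.
  apply: (@le_trans _ _ (\sum_(k < d) 2 * (n * (delta * S x)))); last first.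
    by rewrite sumr_const card_ord -[leLHS]mulr_natl.
  apply: ler_sum => k _; rewrite !normrM -mulrA (ger0_norm (ler0n _ 2)).
  rewrite ler_wpM2l// ler_pM//; first exact: entry_le_enorm.
  by apply: le_trans hH; exact: entry_le_enorm.
have h3 : `|g x ord0 j| * `|\sum_k 2 * g x ord0 k * hess phi x j k| <=
    n * (d%:R * (2 * (n * (delta * S x)))).
  by rewrite ler_pM//; exact: entry_le_enorm.
have -> : delta * (1 + 2 * d%:R) * S x ^+ 2 =
    delta * S x ^+ 2 + n * (d%:R * (2 * (n * (delta * S x)))).
  by rewrite -nS; ring.
exact: lerD.
Qed.

Lemma field_dir_bound j x : `|field_dir j x| * weight phi x <= 2 /\
  `|g x ord0 j * field_dir j x| <= 1 /\ `|field_dir j x| <= 1.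
Proof.
set m := Num.max (S x) 1; have m1 : 1 <= m by rewrite le_max lexx orbT.
have mS : S x <= m by rewrite le_max lexx.
have m0 : 0 < m by lra.
set n := enorm (g x); have n0 : 0 <= n by exact: enorm_ge0.
have nm : n ^+ 2 <= m by rewrite /n -sqnE.
have n1m : n <= m by nra.
have gn : `|g x ord0 j| <= n by exact: entry_le_enorm.
have g0 := normr_ge0 (g x ord0 j).
have E : `|field_dir j x| = `|g x ord0 j| / m.
  by rewrite /field_dir normrM normfV (ger0_norm (ltW m0)).
rewrite [X in _ /\ X <= _ /\ _]normrM E /weight -/(g x) -/n; split; [|split].
- by rewrite mulrAC ler_pdivrMr//; nra.
- by rewrite mulrA ler_pdivrMr//; nra.
- by rewrite ler_pdivrMr//; lra.
Qed.

Let sigma_norm : `|sigma| = 1.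
Proof.
by apply/eqP; rewrite -(@eqrXn2 _ 2)// expr1n real_normK ?num_real// sigma2.
Qed.

Lemma outer_field_bound j x :
  `|outer_field j x| * weight phi x <= 2 * expR (sigma * phi x).
Proof.
have [+ _] := field_dir_bound j x; rewrite /outer_field.
have E0 := expR_gt0 (sigma * phi x).
move: (field_dir j x) => b h; rewrite !normrM sigma_norm mul1r (ger0_norm (ltW E0)) (ger0_norm (eta_ge0 x)).
rewrite (_ : _ * weight phi x = expR (sigma * phi x) *
  (eta x * (`|b| * weight phi x))); last by ring.
rewrite [leRHS]mulrC ler_wpM2l ?(ltW E0)// -[leRHS]mul1r.
by apply: ler_pM; rewrite ?eta_ge0 ?eta_le1// mulr_ge0// ltW// (lt_le_trans _ (weight_ge1 _ _)).
Qed.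

Lemma douter_field_bound j x N : `|x| <= N ->
  `|douter_field j x| <= expR (sigma * phi x) * (2 + 8 * N).
Proof.
move=> xN; have [_ [h1 h2]] := field_dir_bound j x.
have N0 : 0 <= N by apply: le_trans xN.
have E0 := expR_gt0 (sigma * phi x).
rewrite /douter_field; move: (field_dir j x) h1 h2 => b h1 h2.
have t1 : `|sigma * g x ord0 j * (eta x * b)| <= 1.
  rewrite (_ : _ * _ = sigma * (eta x * (g x ord0 j * b))); last by ring.
  rewrite normrM [X in _ * X]normrM sigma_norm mul1r (ger0_norm (eta_ge0 x)) -[leRHS]mul1r.
  by rewrite ler_pM ?eta_ge0 ?eta_le1.
have t2 : `|deta x * (2 * x ord0 j) * b| <= 8 * N.
  move: (deta x) (deta_ge0 x) (deta_le4 x) => D D0 D4.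
  rewrite !normrM (ger0_norm D0) (ger0_norm (ler0n _ 2)).
  have xj : `|x ord0 j| <= N by apply: le_trans xN; exact: coord_le_norm.
  rewrite (_ : 8 * N = 4 * (2 * N) * 1); last by ring.
  by rewrite ler_pM ?mulr_ge0// ler_pM ?mulr_ge0// ler_wpM2l.
have t3 : `|eta x * dfield_dir j x| <= 1.
  have [Tx|xT] := leP T (enorm x); last first.
    have [-> _] := @eta_in x (ltW (lt_trans xT tauT)).
    by rewrite mul0r normr0.
  rewrite normrM (ger0_norm (eta_ge0 x)) -[leRHS]mul1r.
  rewrite ler_pM ?eta_ge0 ?eta_le1//; apply: le_trans (dfield_dir_bound j Tx) _.
  have d0 : 0 <= d%:R :> R by [].
  by rewrite ler_pdivrMl; nra.
rewrite normrM [X in _ * X]normrM sigma_norm mul1r (ger0_norm (ltW E0)).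
rewrite ler_wpM2l ?(ltW E0)//.
apply: le_trans (ler_normD _ _) _.
have := ler_normD (deta x * (2 * x ord0 j) * b) (eta x * dfield_dir j x).
by lra.
Qed.

Let sum_dfield_dir x : T <= enorm x -> `|\sum_j dfield_dir j x| <= 2^-1.
Proof.
move=> Tx; apply: le_trans (ler_norm_sum _ _ _) _.
apply: (@le_trans _ _ (\sum_(j < d) (2 * d%:R * (1 + 2 * d%:R) + 1)^-1 * (1 + 2 * d%:R))).
  by apply: ler_sum => j _; exact: dfield_dir_bound.
rewrite sumr_const card_ord -[leLHS]mulr_natl.
have d0 : 0 <= d%:R :> R by [].
by rewrite mulrCA ler_pdivrMl; nra.
Qed.

(** The square of the sign disappears from the term in which the derivative
    falls on the density. *)
Lemma div_outer_field x : \sum_j douter_field j x =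
  expR (sigma * phi x) * (eta x * \sum_j g x ord0 j * field_dir j x +
   sigma * (2 * deta x * \sum_j x ord0 j * field_dir j x +
    eta x * \sum_j dfield_dir j x)).
Proof.
rewrite !mulr_sumr -!big_split/= !mulr_sumr -!big_split/= mulr_sumr.
apply: eq_bigr => j _; rewrite /douter_field.
set a := expR _; set b := field_dir _ _; set u := dfield_dir _ _.
transitivity (a * (sigma ^+ 2 * (eta x * (g x ord0 j * b)) +
  sigma * (2 * deta x * (x ord0 j * b) + eta x * u))); first by ring.
by rewrite sigma2 mul1r.
Qed.

Let sum_grad_dir x : T <= enorm x -> \sum_j g x ord0 j * field_dir j x = 1.
Proof.
move=> Tx; have Sx4 := S4 Tx.
have m : Num.max (S x) 1 = S x by rewrite max_l//; lra.
rewrite (eq_bigr (fun j => g x ord0 j ^+ 2 / S x)) => [|j _].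
  have Sx0 : S x != 0 by rewrite gt_eqF//; lra.
  by rewrite -mulr_suml; exact: divff.
by rewrite /field_dir m mulrA -expr2.
Qed.

Let sum_radial_dir x : T <= enorm x -> 0 <= \sum_j x ord0 j * field_dir j x.
Proof.
move=> Tx; have [_ g2 _ cr] := HT Tx.
rewrite (eq_bigr (fun j => x ord0 j * g x ord0 j / Num.max (S x) 1)) => [|j _]; last first.
  by rewrite /field_dir mulrA.
rewrite -mulr_suml divr_ge0 ?le_max ?ler01 ?orbT//.
rewrite -radial_derivativeE mulr_ge0 ?enorm_ge0//; apply: le_trans cr.
by rewrite mulr_ge0 ?enorm_ge0// ltW.
Qed.

(** The radial condition gives the derivative of the cutoff the favourable
    sign, so the transition shell does no harm. *)
Lemma div_outer_field_plus x : sigma = 1 ->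
  expR (phi x) * (eta x / 2) <= \sum_j douter_field j x.
Proof.
move=> s1; rewrite div_outer_field s1 !mul1r ler_wpM2l ?expR_ge0//.
have [Tx|xT] := leP T (enorm x); last first.
  have [-> ->] := @eta_in x (ltW (lt_trans xT tauT)).
  by rewrite mulr0 !mul0r !addr0.
rewrite sum_grad_dir//; have := sum_dfield_dir Tx; have := sum_radial_dir Tx.
rewrite ler_norml => r0 /andP[h1 h2].
have := mulr_ge0 (mulr_ge0 (ler0n R 2) (deta_ge0 x)) r0.
have := eta_ge0 x; nra.
Qed.

Lemma div_outer_field_far x : tau ^+ 2 + 1 <= sqn x ->
  expR (sigma * phi x) / 2 <= \sum_j douter_field j x.
Proof.
move=> xt; have [e1 e2] := eta_out xt.
have tau0 : 0 <= tau by rewrite ltW// (lt_trans _ tauT)// (lt_le_trans _ T1).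
have Tx : T <= enorm x.
  apply: ltW; apply: (lt_trans tauT).
  have h : tau ^+ 2 < sqn x by apply: lt_le_trans xt; rewrite ltrDl.
  by move: h; rewrite sqnE ltr_pXn2r// nnegrE ?enorm_ge0.
rewrite div_outer_field e1 e2 sum_grad_dir// ler_wpM2l ?expR_ge0//.
rewrite mulr0 mul0r add0r !mul1r.
have : `|sigma * \sum_j dfield_dir j x| <= 2^-1.
  by rewrite normrM sigma_norm mul1r; exact: sum_dfield_dir.
by rewrite ler_norml => /andP[]; lra.
Qed.

End outer_field.

(** * Isoperimetric inequalities *)

Section isoperimetry.
Context (R : realType) (d : nat) (phi : 'rV[R]_d -> R).
Hypothesis d0 : (0 < d)%N.
Hypothesis hphi : admissible phi.
Implicit Types (x y : 'rV[R]_d) (A P : set 'rV[R]_d) (psi : 'rV[R]_d -> R).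

Definition harnack psi : Prop := continuous psi /\
  forall b, 0 <= b -> exists2 B, 0 <= B &
    forall x y, weight phi x * `|x - y| <= b -> `|psi y - psi x| <= B.

Definition locally_bounded psi : Prop :=
  forall N, exists M, forall x, `|x| <= N -> psi x <= M.

(** On [P] there is a vector field, bounded for the metric, whose divergence
    with respect to the measure of density [expR psi] is bounded below; [G]
    incorporates the density. *)
Definition calibrated psi P : Prop :=
  exists (G DG : 'I_d -> 'rV[R]_d -> R) (CG c : R),
  [/\ 0 <= CG /\ 0 < c, forall j, continuous (G j),
      forall j x, is_derive x (delta_mx ord0 j) (G j) (DG j x) &
      [/\ forall j x, `|G j x| * weight phi x <= CG * expR (psi x),
          forall N, exists M, forall j x, `|x| <= N -> `|DG j x| <= M &
          forall x, P x -> c * expR (psi x) <= \sum_j DG j x]].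

Definition layer A K : set 'rV[R]_d := A `&` [set x | cutoff (weight phi) A K x < 1].

Let d1 : 1 <= d%:R :> R. Proof. by rewrite ler1n. Qed.

Lemma point_of_norm r : 0 <= r -> exists x : 'rV[R]_d, `|x| = r.
Proof.
move=> r0; exists (const_mx r); apply/eqP; rewrite eq_le; apply/andP; split.
  by apply/norm_leP => // i; rewrite mxE ger0_norm.
rewrite -[leLHS](ger0_norm r0).
by have := coord_le_norm (const_mx r : 'rV[R]_d) (Ordinal d0); rewrite mxE.
Qed.

Lemma outside_bounded A N : (forall x, A x -> `|x| <= N) -> exists y, ~ A y.
Proof.
move=> AN; have [|y yN] := @point_of_norm (`|N| + 1); first by rewrite addr_ge0.
exists y => /AN; rewrite yN; have := ler_norm N; lra.
Qed.

(** Collects the constants of [vector_field_isoperimetry]: those depending on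
    the size of [A] do not enter the conclusion. *)
Lemma calibrated_isoperimetry psi P : harnack psi -> locally_bounded psi ->
  calibrated psi P -> exists2 Q, 0 < Q & forall A N K, open A ->
    (forall x, A x -> `|x| <= N) -> A `<=` P -> 1 <= K ->
    (mu_ psi A <= (Q * K)%:E * mu_ psi (layer A K))%E.
Proof.
move=> [cpsi hpsi] bpsi [G [DG [CG [c [[CG0 c0] cG dG [Gle DGM divG]]]]]].
have [Cw Cw1 HCw] := weight_tame hphi ler01.
have [B B0 HB] := hpsi 1 ler01.
pose Q := (c + d%:R * (Cw ^+ 2 * CG * (1 + expR B))) / c.
have e0 := expR_gt0 B.
have D0 : 0 <= d%:R * (Cw ^+ 2 * CG * (1 + expR B)).
  by rewrite mulr_ge0// mulr_ge0 ?addr_ge0 ?expR_ge0// mulr_ge0// sqr_ge0.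
have Q0 : 0 < Q by rewrite divr_gt0// ltr_pwDl.
exists Q => // A N K oA AN AP K1.
have [y0 y0A] := outside_bounded AN.
have [W HW] := weight_bounded hphi (`|N| + 1).
have [M1 HM1] := bpsi (`|N| + 1).
have [M2 HM2] := DGM (`|N| + 1).
have cexp : continuous (fun x => expR (psi x)).
  exact: (continuous_after cpsi (@continuous_expR R)).
have := @vector_field_isoperimetry R d (weight phi) (fun x => expR (psi x)) K Cw
  (expR B) CG c `|N| W (expR M1 + `|M2|) G DG A y0 (weight_ge1 phi) K1 Cw1 HCw
  (fun x => expR_gt0 (psi x)) cexp _ cG dG Gle oA _ y0A (normr_ge0 N) _ HW _ c0 _.
move=> /(_ _ _ _ _ _)-H.
have {}H : (c%:E * mu_ psi A <= (c + d%:R * (K * Cw ^+ 2 * CG * (1 + expR B)))%:E *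
    mu_ psi (layer A K))%E.
  apply: H.
  - move=> x y xy; rewrite -expRD ler_expR.
    by have := HB x y xy; rewrite ler_norml => /andP[_]; lra.
  - by move=> x /AN xN; apply: le_trans xN (ler_norm N).
  - by move=> x xN; rewrite -[leLHS]addr0 lerD// ler_expR HM1.
  - move=> j x xN; apply: le_trans (HM2 j x xN) _; apply: le_trans (ler_norm _) _.
    by rewrite lerDr expR_ge0.
  - by move=> x /AP; exact: divG.
have Hc : (mu_ psi A = (c^-1)%:E * (c%:E * mu_ psi A))%E.
  by rewrite muleA -EFinM mulVf ?gt_eqF// mul1e.
rewrite Hc; apply: (@le_trans _ _ ((c^-1)%:E * ((c + d%:R * (K * Cw ^+ 2 * CG *
    (1 + expR B)))%:E * mu_ psi (layer A K)))%E).
  by apply: lee_wpmul2l => //; rewrite lee_fin invr_ge0 ltW.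
rewrite muleA -EFinM; apply: lee_wpmul2r.
  by apply: integral_ge0 => x _; rewrite lee_fin expR_ge0.
rewrite lee_fin (_ : Q * K = c^-1 * ((c + d%:R * (Cw ^+ 2 * CG * (1 + expR B))) * K)); last first.
  by rewrite /Q; ring.
rewrite ler_pM2l ?invr_gt0//.
rewrite mulrDl; apply: lerD; first by rewrite ler_peMr// ltW.
by rewrite le_eqVlt; apply/orP; left; apply/eqP; ring.
Qed.

(** The factor [C / kappa] is chosen so that a point where the cutoff is less
    than 1 is joined to the complement by a segment of length at most
    [kappa]. *)
Lemma layer_sub_boundary : exists2 C, 1 <= C & forall A kappa,
  (exists y, ~ A y) -> 0 < kappa -> kappa <= 1 ->
  layer A (C / kappa) `<=` boundary_layer (rho_ phi) A kappa.
Proof.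
have [C C1 HC] := rho_le d0 hphi ler01; exists C => // A kappa [y0 y0A] k0 k1.
have K1 : 1 <= C / kappa.
  by rewrite ler_pdivlMr// mul1r; apply: le_trans k1 C1.
move=> x [Ax fx]; split => //.
have [y Ay] := @cutoff_lt1 R d (weight phi) A (C / kappa) y0 (weight_ge1 phi) K1 y0A x fx.
move=> h; have xy : `|y - x| <= 1.
  rewrite distrC; apply: le_trans (ltW h); rewrite -[leLHS]mul1r ler_wpM2r//.
  by rewrite -[leLHS]mul1r ler_pM// weight_ge1.
apply: ge_ereal_inf; exists (rho_ phi x y)%:E; first by exists y.
rewrite lee_fin; have [_ h2] := HC x y xy; apply: le_trans h2 _.
move: h; rewrite (_ : C / kappa * _ * _ = C * weight phi y * `|x - y| / kappa); last by ring.
by rewrite ltr_pdivrMr// mul1r distrC => /ltW.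
Qed.

Lemma mopen_open A : mopen (rho_ phi) A -> open A.
Proof.
move=> oA; rewrite openE => x Ax; have [r r0 rA] := oA x Ax.
have [C C1 HC] := rho_le d0 hphi ler01.
have Cw0 : 0 < C * weight phi x.
  by rewrite mulr_gt0 ?(lt_le_trans _ C1) ?(lt_le_trans _ (weight_ge1 phi x)).
pose e := Num.min 1 (r / (C * weight phi x)).
have e0 : 0 < e by rewrite lt_min ltr01 divr_gt0.
apply/nbhs_ballP; exists e => // y; rewrite mx_norm_ball /ball_/= distrC lt_min.
move=> /andP[y1 yr]; apply: rA; rewrite /mball/=.
have [h _] := HC x y (ltW y1); apply: le_lt_trans h _.
by rewrite mulrC -ltr_pdivlMr.
Qed.

Lemma mbounded_norm A : mbounded (rho_ phi) A -> exists N, forall x, A x -> `|x| <= N.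
Proof.
move=> [r Ar]; have [[x0 Ax0]|A0] := pselect (exists x, A x); last first.
  by exists 0 => x Ax; exfalso; apply: A0; exists x.
have r10 : 0 <= `|r| + 1 by rewrite addr_ge0.
have [C C1 HC] := rho_ball_subset hphi r10.
exists (`|x0| + (`|r| + 1)) => x Ax.
have [|h _] := HC x0 x (`|r| + 1) r10 (lexx _).
  by apply: le_lt_trans (Ar x0 x Ax0 Ax) _; have := ler_norm r; lra.
by rewrite -[x](subrK x0) addrC; apply: le_trans (ler_normD _ _) _; rewrite lerD2l.
Qed.

Lemma property_I_of_calibrated psi : harnack psi -> locally_bounded psi ->
  calibrated psi setT -> property_I (rho_ phi) (mu_ psi).
Proof.
move=> hpsi bpsi cal; have [Q Q0 HQ] := calibrated_isoperimetry hpsi bpsi cal.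
have [C C1 HC] := layer_sub_boundary.
have C0 : 0 < C by exact: lt_le_trans C1.
exists 1, (Q * C)^-1; split => //; first by rewrite invr_gt0 mulr_gt0.
move=> A /mbounded_norm[N AN] /mopen_open oA kappa k0 k1.
have K1 : 1 <= C / kappa.
  by rewrite ler_pdivlMr// mul1r; apply: le_trans k1 C1.
have H := HQ A N (C / kappa) oA AN (@subsetT _ A) K1.
have a0 : 0 <= (Q * C)^-1 * kappa by rewrite mulr_ge0 ?invr_ge0 ?mulr_ge0// ltW.
apply: le_trans (lee_wpmul2l _ H) _; first by rewrite lee_fin.
rewrite muleA -EFinM (_ : _ * (Q * _) = 1) ?mul1e; last first.
  by field; rewrite !gt_eqF.
by apply: mu_mono; apply: HC => //; exact: outside_bounded AN.
Qed.

Lemma mu_exhaust psi A M : measurable A ->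
  measurable_fun setT (psi : _ -> measurableTypeR R) ->
  (forall n : nat, (mu_ psi (A `&` [set x | (`|x| < n%:R)%R]) <= M)%E) ->
  (mu_ psi A <= M)%E.
Proof.
move=> mA mpsi HM; pose F n : set 'rV[R]_d := A `&` [set x | `|x| < n%:R].
have mF n : measurable (F n).
  apply: measurableI => //.
  have := @measurable_cube R d 0 n%:R.
  rewrite (_ : [set y | _] = [set x : 'rV[R]_d | `|x| < n%:R])//.
  by apply/seteqP; split => x /=; rewrite subr0.
have -> : A = \bigcup_n F n.
  apply/seteqP; split => [x Ax|x [n _ []]//].
  exists (Num.truncn `|x|).+1 => //; split => //=.
  exact: truncnS_gt.
have me : measurable_fun setT (fun x => (expR (psi x))%:E).
  by apply/measurable_EFinP; exact: measurableT_comp.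
have ndF : nondecreasing_seq F.
  move=> m n mn; apply/subsetPset => x [Ax xm]; split => //=.
  by apply: lt_le_trans xm _; rewrite ler_nat.
have := @ge0_nondecreasing_set_cvg_integral _ _ R F (fun x => (expR (psi x))%:E)
  (lebesgue_rV R d) ndF mF (fun i => measurable_funS measurableT (@subsetT _ _) me)
  (fun i x _ => expR_ge0 (psi x)).
move=> /cvge_to_le; apply; apply: nearW => n; exact: HM.
Qed.

Lemma mu_setU_le psi A B : measurable A -> measurable B ->
  measurable_fun setT (psi : _ -> measurableTypeR R) ->
  (mu_ psi (A `|` B) <= mu_ psi A + mu_ psi B)%E.
Proof.
move=> mA mB mpsi.
have me : measurable_fun setT (fun x => (expR (psi x))%:E).
  by apply/measurable_EFinP; exact: measurableT_comp.
have -> : A `|` B = A `|` (B `\` A).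
  apply/seteqP; split => x [Ax|Bx]; [by left| |by left|right].
    by have [Ax|Ax] := pselect (A x); [left|right].
  by case: Bx.
have dj : [disjoint A & B `\` A] by apply/disj_setPS => x [Ax []].
have mBA : measurable (B `\` A) by exact: measurableD.
have mAB : measurable_fun (A `|` (B `\` A)) (fun x => (expR (psi x))%:E).
  exact: measurable_funS me.
rewrite /mu_ ge0_integral_setU//.
by apply: leeD => //; apply: mu_mono => x [].
Qed.

End isoperimetry.

Section inner_field.
Context (R : realType) (d : nat) (a : R).
Implicit Types (x : 'rV[R]_d).

(** The radial field with a C^1 compactly supported coefficient: its divergence
    is positive for [|x|^2 < a d / (d + 4)]. *)
Definition inner_field j x : R := pos2 (a - sqn x) * x ord0 j.

Definition dinner_field j x : R :=
  pos2 (a - sqn x) - 4 * posp (a - sqn x) * x ord0 j ^+ 2.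

Lemma inner_field_continuous j : continuous (inner_field j).
Proof.
apply: continuous_mul; last exact: coord_continuous.
have c1 := continuous_sub (@continuous_const R _ a) (@sqn_continuous R d).
exact: (continuous_after c1 (@pos2_continuous R)).
Qed.

Lemma is_derive_inner_field j x :
  is_derive x (delta_mx ord0 j) (inner_field j) (dinner_field j x).
Proof.
have H : is_derive x (delta_mx ord0 j) (fun y => a - sqn y) (- 1 * (2 * x ord0 j)).
  have := is_derive_add (is_derive_cst a x (delta_mx ord0 j : 'rV[R]_d))
    (is_derive_scalar (- 1) (is_derive_sqn_e x j)).
  rewrite add0r (_ : (fun _ => _) = (fun y => a - sqn y))//.
  by apply/funext => y; rewrite mulN1r.
have H1 := is_derive_chain (is_derive_pos2 _) H.
have D := is_derive_mul H1 (is_derive_coordinate x j (delta_mx ord0 j)).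
by apply: (is_derive_eq D); rewrite mxE !eqxx /= /dinner_field; ring.
Qed.

Lemma div_inner_field x : \sum_j dinner_field j x =
  d%:R * pos2 (a - sqn x) - 4 * posp (a - sqn x) * sqn x.
Proof. by rewrite sumrB sumr_const card_ord -[_ *+ d]mulr_natl -mulr_sumr. Qed.

Lemma entry_le_sqn x j : `|x ord0 j| <= 1 + sqn x.
Proof.
have h : x ord0 j ^+ 2 <= sqn x.
  by rewrite /sqn (bigD1 j)//= lerDl sumr_ge0// => k _; rewrite sqr_ge0.
by rewrite ler_norml; apply/andP; split; nra.
Qed.

Lemma norm_le_sqn x : `|x| <= 1 + sqn x.
Proof. by apply/norm_leP => [|i]; [rewrite addr_ge0 ?sqn_ge0|exact: entry_le_sqn]. Qed.

Hypothesis a0 : 0 <= a.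

Let u_le x : posp (a - sqn x) <= a.
Proof. by apply: posp_le => //; rewrite gerBl sqn_ge0. Qed.

Lemma inner_field_bound j x :
  inner_field j x = 0 \/ sqn x <= a /\ `|inner_field j x| <= a ^+ 2 * (1 + a).
Proof.
have [xa|/ltW ax] := leP (sqn x) a; [right; split => //|left]; last first.
  by rewrite /inner_field pos2_0 ?mul0r// subr_le0.
rewrite /inner_field normrM (ger0_norm (pos2_ge0 _)) ler_pM//.
- exact: pos2_ge0.
- by rewrite /pos2 lerXn2r// nnegrE posp_ge0.
- by apply: le_trans (entry_le_sqn x j) _; rewrite lerD2l.
Qed.

Lemma dinner_field_bound j x N : `|x| <= N ->
  `|dinner_field j x| <= a ^+ 2 + 4 * a * N ^+ 2.
Proof.
move=> xN; apply: le_trans (ler_normB _ _) _; apply: lerD.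
  rewrite (ger0_norm (pos2_ge0 _)) /pos2 lerXn2r// nnegrE posp_ge0//.
rewrite normrM normrX (ger0_norm (mulr_ge0 (ler0n _ 4) (posp_ge0 _))).
have xj : `|x ord0 j| <= N by apply: le_trans xN; exact: coord_le_norm.
apply: ler_pM => //; rewrite ?mulr_ge0 ?posp_ge0 ?exprn_ge0//.
  by rewrite ler_wpM2l.
by rewrite lerXn2r// nnegrE//; apply: le_trans xj.
Qed.

End inner_field.

Section calibrations.
Context (R : realType) (d : nat) (phi : 'rV[R]_d -> R).
Hypothesis d0 : (0 < d)%N.
Hypothesis hphi : admissible phi.
Implicit Types (x y : 'rV[R]_d).

Let d1 : 1 <= d%:R :> R. Proof. by rewrite ler1n. Qed.

Let cphi : continuous phi.
Proof. by move=> x; apply: differentiable_continuous; have [[]] := hphi. Qed.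

Lemma harnack_plus : harnack phi phi.
Proof. by split => // b b0; exact: potential_harnack. Qed.

Lemma harnack_minus : harnack phi (fun x => - phi x).
Proof.
split; first by move=> x; apply: continuousN; exact: cphi.
move=> b b0; have [B B0 HB] := potential_harnack hphi b0; exists B => // x y xy.
by rewrite -opprD normrN; exact: HB.
Qed.

Lemma locally_bounded_plus : locally_bounded phi.
Proof.
move=> N; have [B HB] := potential_bounded hphi N; exists B => x /HB.
exact: le_trans (ler_norm _).
Qed.

Lemma locally_bounded_minus : locally_bounded (fun x => - phi x).
Proof.
move=> N; have [B HB] := potential_bounded hphi N; exists B => x /HB.
by rewrite -normrN; exact: le_trans (ler_norm _).
Qed.

Let delta_gt0 : 0 < (2 * d%:R * (1 + 2 * d%:R) + 1 : R)^-1.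
Proof. by rewrite invr_gt0 ltr_wpDl// !mulr_ge0// addr_ge0. Qed.

(** Where [eta] increases, the derivative of the cutoff has the unfavourable
    sign for the decaying density, so the region starts where [eta = 1]. *)
Lemma calibrated_minus : exists2 b : R, 0 < b &
  calibrated phi (fun x => - phi x) [set x | b <= sqn x].
Proof.
have [c [T [c0 T1 HT]]] := asymptotics hphi delta_gt0.
pose tau := T + 1; have tauT : T < tau by rewrite ltrDl.
have s2 : (- 1 : R) ^+ 2 = 1 by rewrite sqrrN expr1n.
exists (tau ^+ 2 + 1); first by rewrite ltr_wpDl// sqr_ge0.
exists (outer_field phi tau (- 1)), (douter_field phi tau (- 1)), 2, 2^-1.
split => //.
- by move=> j; exact: outer_field_continuous.
- by move=> j x; exact: (is_derive_outer_field hphi (- 1) tauT HT).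
split.
- by move=> j x; have := outer_field_bound phi tau s2 j x; rewrite mulN1r.
- move=> N; have [M HM] := locally_bounded_minus N.
  exists (expR M * (2 + 8 * N)) => j x xN.
  apply: le_trans (douter_field_bound tauT s2 HT j xN) _.
  rewrite ler_wpM2r ?mulN1r ?ler_expR ?HM//.
  by rewrite addr_ge0// mulr_ge0//; apply: le_trans xN.
- move=> x xt; have := div_outer_field_far T1 tauT s2 HT xt.
  by rewrite mulN1r mulrC.
Qed.

(** A small multiple of the inner field provides the divergence where [eta] may
    vanish; where its own divergence is negative, [eta = 1] and the outer field
    wins. *)
Lemma calibrated_plus : calibrated phi phi setT.
Proof.
have [c [T [c0 T1 HT]]] := asymptotics hphi delta_gt0.
pose tau := T + 1; have tauT : T < tau by rewrite ltrDl.
have s2 : (1 : R) ^+ 2 = 1 by rewrite expr1n.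
pose b := tau ^+ 2 + 1; have b0 : 0 < b by rewrite ltr_wpDl// sqr_ge0.
(* large enough for the inner field to have positive divergence on the ball
   outside which [eta = 1] *)
pose a := 6 * b; have a0 : 0 < a by rewrite mulr_gt0.
have [W HW] := weight_bounded hphi (1 + a).
have [B HB] := potential_bounded hphi (1 + a).
have W0 : 0 <= W.
  apply: (@le_trans _ _ (weight phi 0)); first exact: le_trans (weight_ge1 _ _).
  by apply: HW; rewrite normr0 addr_ge0// ltW.
pose lo := expR (- B); pose hi := expR B.
have lo0 : 0 < lo by exact: expR_gt0.
have hi0 : 0 < hi by exact: expR_gt0.
have near_lo x : sqn x <= a -> lo <= expR (phi x) <= hi.
  move=> xa; have : `|phi x| <= B.
    by apply: HB; apply: le_trans (norm_le_sqn x) _; rewrite lerD2l.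
  by rewrite ler_norml /lo /hi !ler_expR.
(* the divergence of the inner field is at least [- 4 a^2], that of the outer
   field at least [lo / 2] where [eta = 1] and [sqn <= a] *)
pose eps := lo / (16 * a ^+ 2).
have eps0 : 0 < eps by rewrite divr_gt0// mulr_gt0// exprn_gt0.
pose G j x := outer_field phi tau 1 j x + eps * inner_field a j x.
pose DG j x := douter_field phi tau 1 j x + eps * dinner_field a j x.
exists G, DG, (2 + eps * (a ^+ 2 * (1 + a)) * W / lo), (Num.min 4^-1 (eps * b ^+ 2 / hi)).
split.
- split.
    rewrite addr_ge0// divr_ge0 ?(ltW lo0)// mulr_ge0// mulr_ge0 ?(ltW eps0)//.
    by rewrite mulr_ge0 ?sqr_ge0// addr_ge0// ltW.
  by rewrite lt_min invr_gt0 ltr0n/= divr_gt0// mulr_gt0// exprn_gt0.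
- move=> j; apply: continuous_add; first exact: outer_field_continuous.
  exact: (continuous_mul (@continuous_const R _ eps) (@inner_field_continuous R d a j)).
- move=> j x; apply: is_derive_add.
    exact: (is_derive_outer_field hphi 1 tauT HT).
  by apply: is_derive_scalar; exact: is_derive_inner_field.
split.
- move=> j x; have ho := outer_field_bound phi tau s2 j x; rewrite mul1r in ho.
  have w0 : 0 < weight phi x by exact: lt_le_trans (weight_ge1 _ _).
  apply: (@le_trans _ _ ((`|outer_field phi tau 1 j x| + `|eps * inner_field a j x|) *
      weight phi x)).
    by rewrite ler_pM2r// ler_normD.
  rewrite mulrDl [leRHS]mulrDl; apply: lerD => //.
  rewrite normrM (ger0_norm (ltW eps0)).
  have [->|[xa ib]] := @inner_field_bound R d a (ltW a0) j x.
    rewrite normr0 mulr0 mul0r mulr_ge0 ?expR_ge0// divr_ge0 ?(ltW lo0)//.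
    rewrite mulr_ge0// mulr_ge0 ?(ltW eps0)//.
    by rewrite mulr_ge0 ?sqr_ge0// addr_ge0// ltW.
  have /andP[xlo _] := near_lo x xa.
  have xW : weight phi x <= W.
    by apply: HW; apply: le_trans (norm_le_sqn x) _; rewrite lerD2l.
  apply: (@le_trans _ _ (eps * (a ^+ 2 * (1 + a)) * W)).
    apply: ler_pM => //; [by rewrite mulr_ge0// ltW|exact: ltW|].
    by rewrite ler_wpM2l// ltW.
  rewrite -[leRHS]mulrA ler_peMr//.
    rewrite mulr_ge0// mulr_ge0 ?(ltW eps0)//.
    by rewrite mulr_ge0 ?sqr_ge0// addr_ge0// ltW.
  by rewrite mulrC ler_pdivlMr// mul1r.
- move=> N; have [M HM] := locally_bounded_plus N.
  exists (expR M * (2 + 8 * N) + eps * (a ^+ 2 + 4 * a * N ^+ 2)) => j x xN.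
  apply: le_trans (ler_normD _ _) _; apply: lerD.
    apply: le_trans (douter_field_bound tauT s2 HT j xN) _.
    rewrite ler_wpM2r ?mul1r ?ler_expR ?HM//.
    by rewrite addr_ge0// mulr_ge0//; apply: le_trans xN.
  rewrite normrM (ger0_norm (ltW eps0)) ler_wpM2l ?(ltW eps0)//.
  by apply: dinner_field_bound => //; exact: ltW.
- move=> x _; have -> : \sum_j DG j x = \sum_j douter_field phi tau 1 j x +
      eps * \sum_j dinner_field a j x by rewrite mulr_sumr -big_split.
  rewrite div_inner_field.
  set s := sqn x; set u := posp (a - s); set E := expR (phi x).
  have E0 : 0 < E by exact: expR_gt0.
  have s0 : 0 <= s by exact: sqn_ge0.
  have ep : 0 <= eta tau x by exact: eta_ge0.
  have hdiv := div_outer_field_plus tauT s2 HT c0 x erefl; rewrite -/E in hdiv.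
  have [sb|/ltW bs] := leP s b.
    (* near the origin the inner field provides the divergence *)
    have /andP[_ Ehi] : lo <= E <= hi by apply: near_lo; rewrite -/s /a; lra.
    have uE : u = a - s by rewrite /u pospE// /a; lra.
    have p2 : pos2 (a - s) = u ^+ 2 by [].
    have h1 : b ^+ 2 <= d%:R * pos2 (a - s) - 4 * u * s.
      rewrite p2; have : u ^+ 2 <= d%:R * u ^+ 2 by rewrite ler_peMl// sqr_ge0.
      by rewrite uE /a; nra.
    have h2 : 0 <= E * (eta tau x / 2) by rewrite mulr_ge0 ?(ltW E0)// divr_ge0.
    have h3 : eps * b ^+ 2 <= eps * (d%:R * pos2 (a - s) - 4 * u * s) by rewrite ler_pM2l.
    have h4 : Num.min 4^-1 (eps * b ^+ 2 / hi) * E <= eps * b ^+ 2.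
      apply: (@le_trans _ _ (eps * b ^+ 2 / hi * hi)); last by rewrite divfK// gt_eqF.
      apply: ler_pM => //; last by rewrite ge_min lexx orbT.
        by rewrite le_min invr_ge0 ler0n/= divr_ge0 ?(ltW hi0)// mulr_ge0 ?sqr_ge0// ltW.
      exact: ltW.
    by lra.
  (* outside, the outer field absorbs the negative part of the inner one *)
  have [e1 _] := eta_out bs; rewrite e1 in hdiv.
  have h1 : Num.min 4^-1 (eps * b ^+ 2 / hi) * E <= 4^-1 * E.
    by rewrite ler_pM2r// ge_min lexx.
  have h2 : 0 <= eps * (d%:R * pos2 (a - s)).
    by rewrite mulr_ge0 ?(ltW eps0)// mulr_ge0// pos2_ge0.
  have h3 : eps * (4 * u * s) <= E / 4.
    have [sa|/ltW as_] := leP s a; last first.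
      rewrite /u posp0 ?subr_le0// mulr0 mul0r mulr0.
      by rewrite divr_ge0 ?(ltW E0).
    have /andP[Elo _] := near_lo x sa.
    apply: (@le_trans _ _ (lo / 4)); last by rewrite ler_pM2r// invr_gt0.
    rewrite /eps -mulrA ler_pM2l// ler_pdivrMl ?mulr_gt0 ?exprn_gt0//.
    have ua : u <= a by apply: posp_le; rewrite ?(ltW a0)// gerBl.
    have : u * s <= a * a by rewrite ler_pM ?posp_ge0.
    by rewrite expr2; lra.
  by lra.
Qed.

End calibrations.

(** * The finite measure *)

Section finite_measure.
Context (R : realType) (d : nat) (phi : 'rV[R]_d -> R).
Hypothesis d0 : (0 < d)%N.
Hypothesis hphi : admissible phi.
Implicit Types (x y : 'rV[R]_d) (A : set 'rV[R]_d).

Local Notation mu := (mu_ (fun x => - phi x)).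

Definition annulus n : set 'rV[R]_d := [set x | n%:R - 1 < `|x| /\ `|x| < n%:R].

Let mphi : measurable_fun setT ((fun x => - phi x) : _ -> measurableTypeR R).
Proof. by apply: continuous_measurable_rV; have [] := harnack_minus hphi. Qed.

Let mu_ge0 A : (0 <= mu A)%E.
Proof. by apply: integral_ge0 => x _; rewrite lee_fin expR_ge0. Qed.

Lemma measurable_annulus n : measurable (annulus n).
Proof.
have mn := continuous_measurable_rV (@norm_continuous R 'rV[R]_d).
have := mn measurableT [set` `]n%:R - 1, n%:R[] (measurable_itv _).
rewrite setTI; congr measurable; apply/seteqP; split => x /=; rewrite in_itv/=.
  by move=> /andP.
by case=> ? ?; apply/andP.
Qed.

(** The density decays exponentially and the volume grows polynomially:
    [expR (c n)] is compared with the power [d + 1] of [n]. *)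
Lemma mu_annulus_le : exists2 F, 0 <= F &
  forall n, (0 < n)%N -> (mu (annulus n) <= (F / n%:R)%:E)%E.
Proof.
have [c [C [c0 HC]]] := potential_growth hphi.
pose k : R := d.+1%:R; have k0 : 0 < k by [].
exists (expR (C + c) * (2 ^+ d * (k / c) ^+ d.+1)) => [|n n0].
  by rewrite mulr_ge0 ?expR_ge0// mulr_ge0// exprn_ge0// divr_ge0 ?ltW.
have n1 : 0 < n%:R :> R by rewrite ltr0n.
pose M := C + c - c * n%:R.
pose Q : set 'rV[R]_d := [set y | `|y - 0| < n%:R].
apply: (@le_trans _ _ (\int[lebesgue_rV R d]_(y in Q) (cst (expR M)%:E) y)%E).
  apply: ge0_integral_mono => x.
  - by move=> _; rewrite lee_fin expR_ge0.
  - by move=> _; rewrite lee_fin expR_ge0.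
  - move=> [x1 x2]; split; first by rewrite /Q/= subr0.
    rewrite lee_fin ler_expR /M; have := HC x.
    have : c * (n%:R - 1) <= c * `|x| by rewrite ler_pM2l// ltW.
    by lra.
rewrite integral_cst; last exact: measurable_cube.
rewrite [X in (_ * X)%E]lebesgue_rV_cube// -EFinM lee_fin.
pose y := c * n%:R / k; have y0 : 0 < y by rewrite !divr_gt0// mulr_gt0.
have yk : y ^+ d.+1 <= expR (c * n%:R).
  have -> : c * n%:R = d.+1%:R * y by rewrite /y; field; rewrite gt_eqF.
  rewrite expRM_natl lerXn2r ?nnegrE ?expR_ge0 ?(ltW y0)//.
  by apply: le_trans (expR_ge1Dx y); rewrite lerDr.
rewrite /M expRD expRN -[leLHS]mulrA -[leRHS]mulrA ler_wpM2l ?expR_ge0//.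
rewrite ler_pdivrMl ?expR_gt0//.
apply: (@le_trans _ _ (y ^+ d.+1 * (2 ^+ d * (k / c) ^+ d.+1 / n%:R))); last first.
  rewrite ler_wpM2r// divr_ge0// mulr_ge0// exprn_ge0// divr_ge0 ?(ltW k0) ?(ltW c0)//.
pose z := k / c; have z0 : 0 < z by rewrite divr_gt0.
rewrite -/z (_ : y = n%:R / z); last by rewrite /y /z invf_div; ring.
move: z z0 => z z0; rewrite [leRHS](_ : _ = (2 * n%:R) ^+ d)//.
rewrite expr_div_n exprMn !exprS; field.
by rewrite !gt_eqF// exprn_gt0.
Qed.

(** A point near the complement of the truncated set is near the complement of
    [A] or within distance 1 of the truncation sphere. *)
Lemma layer_truncate A K y0 n : 1 <= K -> ~ A y0 ->
  layer phi (A `&` [set x | `|x| < n%:R]) K `<=` layer phi A K `|` annulus n.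
Proof.
move=> K1 y0A x [[Ax xn] fx].
have w1 := weight_ge1 phi; have y0n : ~ (A `&` [set x | `|x| < n%:R]) y0 by case.
have [y Ay h] := cutoff_lt1 w1 K1 y0n fx.
have [Ay'|Ay'] := pselect (A y); last first.
  left; split => //=; apply: le_lt_trans (cutoff_le w1 K1 y0A x Ay') _.
  by rewrite gt_min h orbT.
right; split => //; have yn : n%:R <= `|y|.
  by rewrite leNgt; apply/negP => yn; apply: Ay.
have xy : `|x - y| < 1.
  apply: le_lt_trans h; rewrite -[leLHS]mul1r ler_wpM2r//.
  by rewrite -[leLHS]mul1r ler_pM.
have : `|y| <= `|x| + `|x - y|.
  by rewrite -{1}[y](subKr x); exact: ler_normB.
by lra.
Qed.

Lemma open_norm_lt r : open [set x : 'rV[R]_d | `|x| < r].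
Proof.
rewrite (_ : [set x | _] = (fun x : 'rV[R]_d => `|x|) @^-1` [set` `]-oo, r[]).
  apply: open_comp; last exact: interval_open.
  by move=> x _; exact: norm_continuous.
by apply/seteqP; split => x /=; rewrite in_itv.
Qed.

(** The extra layer created by truncating to the ball of radius [n] has measure
    [O(1/n)], so [A] may be exhausted by its truncations. *)
Lemma isoperimetry_minus : exists b Q, [/\ 0 < b, 0 < Q &
  forall A K y0, open A -> ~ A y0 -> A `<=` [set x | b <= sqn x] -> 1 <= K ->
    (mu A <= (Q * K)%:E * mu (layer phi A K))%E].
Proof.
have [b b0 cal] := calibrated_minus hphi.
have [Q Q0 HQ] := calibrated_isoperimetry d0 hphi (harnack_minus hphi)
  (locally_bounded_minus hphi) cal.
have [F F0 HF] := mu_annulus_le.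
exists b, Q; split => // A K y0 oA y0A AP K1.
have K0 : 0 < K by exact: lt_le_trans K1.
have mA := open_measurable_rV oA.
apply: mu_exhaust => // m; apply/lee_addgt0Pr => e e0.
pose n := maxn m (Num.truncn (Q * K * F / e)).+1.
have n0 : (0 < n)%N by rewrite leq_max orbT.
have nm : (m <= n)%N by rewrite leq_maxl.
have QKFn : Q * K * (F / n%:R) <= e.
  rewrite mulrA ler_pdivrMr ?ltr0n// [leRHS]mulrC -ler_pdivrMr//.
  apply: le_trans (ltW (truncnS_gt _)) _.
  by rewrite ler_nat leq_maxr.
have mL : measurable (layer phi A K).
  apply: measurableI => //.
  have [Cw Cw1 HCw] := weight_tame hphi ler01.
  have cf := cutoff_continuous (weight_ge1 phi) K1 Cw1 HCw y0A.
  have mcf := continuous_measurable_rV cf.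
  have := mcf measurableT [set` `]-oo, 1[] (measurable_itv _).
  rewrite setTI (_ : _ @^-1` _ = [set x | cutoff (weight phi) A K x < 1])//.
have oAn : open (A `&` [set x | `|x| < n%:R]).
  by apply: openI => //; exact: open_norm_lt.
apply: (@le_trans _ _ (mu (A `&` [set x | `|x| < n%:R]))).
  apply: mu_mono => x [Ax xm]; split => //=.
  by apply: lt_le_trans xm _; rewrite ler_nat.
apply: le_trans (HQ _ n%:R K oAn _ _ K1) _.
- by move=> x [_ /ltW].
- by move=> x [/AP].
apply: (@le_trans _ _ ((Q * K)%:E * (mu (layer phi A K) + (F / n%:R)%:E))%E).
  apply: lee_wpmul2l; first by rewrite lee_fin mulr_ge0// ltW.
  apply: le_trans (mu_mono _ (layer_truncate K1 y0A)) _.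
  apply: le_trans (mu_setU_le mL (measurable_annulus n) mphi) _.
  by apply: leeD => //; exact: HF.
rewrite ge0_muleDr//; last by rewrite lee_fin divr_ge0.
by apply: leeD => //; rewrite -EFinM lee_fin.
Qed.

Lemma mu_norm_lt_fin r : (mu [set x | (`|x| < r)%R] < +oo)%E.
Proof.
have [M HM] := locally_bounded_minus hphi r.
pose r' := `|r| + 1; have r'0 : 0 < r' by rewrite ltr_wpDl.
have [M' HM'] := locally_bounded_minus hphi r'.
apply: (@le_lt_trans _ _ (mu [set y | (`|y - 0| < r')%R])).
  apply: mu_mono => x /= xr; rewrite subr0 (lt_trans xr)//.
  by apply: le_lt_trans (ler_norm r) _; rewrite ltrDl.
apply: le_lt_trans (@mu_cube_le _ _ _ 0 r' M' r'0 _) (ltry _).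
by move=> y; rewrite subr0 => /ltW; exact: HM'.
Qed.

(** The isoperimetric inequality for the complement of a ball bounds its measure
    by that of a bounded layer. *)
Lemma mu_finite : (mu [set: 'rV[R]_d] < +oo)%E.
Proof.
have [b [Q [b0 Q0 HQ]]] := isoperimetry_minus.
pose A : set 'rV[R]_d := [set x | b < sqn x].
have oA : open A.
  rewrite (_ : A = @sqn R d @^-1` [set` `]b, +oo[]).
    apply: open_comp; last exact: interval_open.
    by move=> x _; exact: sqn_continuous.
  by apply/seteqP; split => x /=; rewrite in_itv/= andbT.
have nA0 : ~ A 0.
  rewrite /A/= /sqn big1 => [|k _]; last by rewrite mxE expr0n.
  by apply/negP; rewrite -leNgt ltW.
have near_b y : ~ A y -> `|y| <= 1 + b.
  move=> /negP; rewrite -leNgt => yb.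
  by apply: le_trans (norm_le_sqn y) _; rewrite lerD2l.
have AP : A `<=` [set x | b <= sqn x] by move=> x /ltW.
have Afin : (mu A < +oo)%E.
  apply: le_lt_trans (HQ A 1 0 oA nA0 AP (lexx 1)) _.
  apply: lte_mul_pinfty => //; first by rewrite lee_fin mulr1 ltW.
  apply: le_lt_trans (mu_norm_lt_fin (b + 3)).
  apply: mu_mono => x [_ fx] /=.
  have [y Ay] := cutoff_lt1 (weight_ge1 phi) (lexx 1) nA0 fx.
  rewrite mul1r => h; have xy : `|x - y| < 1.
    by apply: le_lt_trans h; rewrite ler_peMl// weight_ge1.
  have := near_b y Ay; have := ler_normD (x - y) y; rewrite subrK; lra.
have mcube : measurable [set x : 'rV[R]_d | `|x| < b + 2].
  by apply: open_measurable_rV; exact: open_norm_lt.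
apply: le_lt_trans (lte_add_pinfty Afin (mu_norm_lt_fin (b + 2))).
apply: le_trans (mu_setU_le (open_measurable_rV oA) mcube mphi).
apply: mu_mono => x _; have [Ax|/near_b xb] := pselect (A x); [by left|right].
by rewrite /=; lra.
Qed.

(** The metric ball is taken so large that its closure contains the Euclidean
    ball outside which the vector field is calibrated. *)
Lemma property_Ic_minus : exists (c : 'rV[R]_d) (r : R), 0 < r /\
  property_Ic (rho_ phi) mu (mball (rho_ phi) c r).
Proof.
have [b [Q [b0 Q0 HQ]]] := isoperimetry_minus.
have [C C1 HC] := layer_sub_boundary d0 hphi.
have C0 : 0 < C by exact: lt_le_trans C1.
have b10 : 0 <= 1 + b by rewrite addr_ge0// ltW.
have [C' C'1 HC'] := rho_le d0 hphi b10.
have C'0 : 0 < C' by exact: lt_le_trans C'1.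
have w0 : 0 < weight phi 0 by exact: lt_le_trans (weight_ge1 _ _).
pose r := C' * weight phi 0 * (1 + b) + 1.
have r0 : 0 < r by rewrite ltr_wpDl// mulr_ge0// mulr_ge0 ?ltW.
exists 0, r; split => //; exists 1, (Q * C)^-1; split => //.
  by rewrite invr_gt0 mulr_gt0.
move=> A /(mopen_open d0 hphi) oA AB kappa k0 k1.
have ball_b x : sqn x <= b -> mclosure (rho_ phi) (mball (rho_ phi) 0 r) x.
  move=> xb e e0; exists x; split.
    have [|h _] := HC' x x _; first by rewrite subrr normr0.
    by rewrite /mball/=; apply: le_lt_trans h _; rewrite subrr normr0 mulr0.
  have xb1 : `|x - 0| <= 1 + b.
    by rewrite subr0; apply: le_trans (norm_le_sqn x) _; rewrite lerD2l.
  have [h _] := HC' 0 x xb1; rewrite /mball/=; apply: le_lt_trans h _.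
  by rewrite /r ltr_pwDr// ler_wpM2l// mulr_ge0 ?ltW.
have AP : A `<=` [set x | b <= sqn x].
  by move=> x /AB xB /=; rewrite leNgt; apply/negP => /ltW /ball_b.
have A0 : ~ A 0.
  move=> /AB; apply; apply: ball_b.
  by rewrite /sqn big1 ?(ltW b0)// => k _; rewrite mxE expr0n.
have K1 : 1 <= C / kappa.
  by rewrite ler_pdivlMr// mul1r; apply: le_trans k1 C1.
have H := HQ A (C / kappa) 0 oA A0 AP K1.
have a0 : 0 <= (Q * C)^-1 * kappa by rewrite mulr_ge0 ?invr_ge0 ?mulr_ge0// ltW.
apply: le_trans (lee_wpmul2l _ H) _; first by rewrite lee_fin.
rewrite muleA -EFinM (_ : _ * (Q * _) = 1) ?mul1e; last first.
  by field; rewrite !gt_eqF.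
by apply: mu_mono; apply: HC => //; exists 0.
Qed.

End finite_measure.

Theorem theorem8p7 (R : realType) (d : nat) (hd : (0 < d)%N)
    (phi : 'rV[R]_d -> R) (hphi : admissible phi) :
  [/\ locally_doubling (rho_ phi) (mu_ phi),
      mu_ phi [set: 'rV[R]_d] = +oo%E &
      property_I (rho_ phi) (mu_ phi)] /\
  [/\ locally_doubling (rho_ phi) (mu_ (fun x => - phi x)),
      (mu_ (fun x => (- phi x)%R) [set: 'rV[R]_d] < +oo)%E &
      exists (c : 'rV[R]_d) (r : R), 0 < r /\
        property_Ic (rho_ phi) (mu_ (fun x => - phi x)) (mball (rho_ phi) c r)].
Proof.
split; split.
- by apply: (doubling hd hphi); have [] := harnack_plus hphi.
- exact: mu_infinite.
- apply: (property_I_of_calibrated hd hphi (harnack_plus hphi)).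
    exact: locally_bounded_plus.
  exact: calibrated_plus.
- by apply: (doubling hd hphi); have [] := harnack_minus hphi.
- exact: mu_finite.
- exact: property_Ic_minus.
Qed.
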